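(* Let $G$ be a finitely generated virtually nilpotent group. Set $k=d(G)$. Then for any non-negative integer $d$ we have $$\mathrm{LSP}_d(G)\leq 3^k(d+1).$$
   Context: For a nilpotent group $N$ with descending central series $N_1=N$, $N_{n+1}=[N_n,N]$, $\operatorname{Rk}_n(N)$ is the rank of the abelian group $N_n/N_{n+1}$, i.e. $\dim_{\mathbb{Q}}(\mathbb{Q}\otimes_{\mathbb{Z}}(N_n/N_{n+1}))$. For a virtually nilpotent group $G$ with a nilpotent subgroup $N$ of finite index, $\operatorname{Rk}_n(G)=\operatorname{Rk}_n(N)$ (independent of $N$), and $d(G)=\sum_{n\geq1}n\operatorname{Rk}_n(G)$ (the degree of polynomial growth of $G$). Large scale packing constants: for a discrete group $G$ and a nonnegative integer $d$, $\mathrm{LSP}_d(G)$ is the infimum of all nonnegative integers $m$ such that for any finite subset $L\subseteq G$ there is a finite symmetric subset $N\subseteq G$ containing $e$ (so $e\in N=N^{-1}$) with the property: for any $n>m$ and any $g_1,\dots,g_n\in NL$ there is a subset $F\subseteq\{1,\dots,n\}$ with $|F|>d+1$ and $g_ig_j^{-1}\in N$ for all $i,j\in F$. Here $NL=\{ab\colon a\in N,b\in L\}$. *)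

(* Defs.v *)
From HB Require Import structures.
From mathcomp Require Import all_boot all_order all_algebra.
From mathcomp Require Import boolp classical_sets cardinality fsbigop.
From mathcomp Require Import reals ereal.

Set Implicit Arguments.
Unset Strict Implicit.
Unset Printing Implicit Defensive.

Import Order.TTheory GRing.Theory Num.Theory.

Local Open Scope classical_set_scope.
Local Open Scope group_scope.

Section Subgroups.
Variable G : groupType.
Implicit Types H K S : set G.

Definition is_subgroup H : Prop :=
  [/\ H 1, (forall x y, H x -> H y -> H (x * y)) & (forall x, H x -> H x^-1)].

Definition generated S : set G := smallest is_subgroup S.

Definition finitely_generated : Prop :=
  exists2 S : set G, finite_set S & generated S = [set: G].

Definition setmul H K : set G := [set x * y | x in H & y in K].

Definition commutator_subgroup H K : set G :=
  generated [set [~ x, y] | x in H & y in K].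

(* The indices start at 0: [lcs N n] is the term N_{n+1} of the descending
   central series N_1 = N, N_{n+1} = [N_n, N]. *)
Fixpoint lcs H (n : nat) : set G :=
  if n is m.+1 then commutator_subgroup (lcs H m) H else H.

Definition is_nilpotent H : Prop := exists c, lcs H c = [set 1].

Definition lcoset K (x : G) : set G := [set x * y | y in K].

Definition cosets H K : set (set G) := lcoset K @` H.

Definition finite_index H : Prop := finite_set (cosets [set: G] H).

Definition is_virtually_nilpotent : Prop :=
  exists N, [/\ is_subgroup N, is_nilpotent N & finite_index N].

End Subgroups.

(* The data needed to form an abelian quotient H / K; [abq_comm] makes K normal
   in H and H / K abelian. *)
Record abelian_section (G : groupType) := AbelianSection {
  abq_num : set G;
  abq_den : set G;
  abq_numP : is_subgroup abq_num;
  abq_denP : is_subgroup abq_den;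
  abq_sub : abq_den `<=` abq_num;
  abq_comm : forall x y, abq_num x -> abq_num y -> abq_den [~ x, y] }.

Section AbelianQuotient.
Variables (G : groupType) (S : abelian_section G).
Let H := abq_num S.
Let K := abq_den S.

Record abq : Type := Abq { abq_val : set G; _ : abq_val \in cosets H K }.
HB.instance Definition _ := [isSub for abq_val].
HB.instance Definition _ := [Choice of abq by <:].

Let K1 : K 1. Proof. by case: (abq_denP S). Qed.
Let KM x y : K x -> K y -> K (x * y).
Proof. by case: (abq_denP S) => _ + _; apply. Qed.
Let KV x : K x -> K x^-1.
Proof. by case: (abq_denP S) => _ _; apply. Qed.
Let H1 : H 1. Proof. by case: (abq_numP S). Qed.
Let HM x y : H x -> H y -> H (x * y).
Proof. by case: (abq_numP S) => _ + _; apply. Qed.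
Let HV x : H x -> H x^-1.
Proof. by case: (abq_numP S) => _ _; apply. Qed.
Let KH x : K x -> H x. Proof. exact: abq_sub. Qed.

Let KJ x y : H x -> K y -> K (x^-1 * y * x).
Proof.
move=> Hx Ky; have -> : x^-1 * y * x = y * [~ y, x].
  by rewrite /commg /conjg mulVKg mulgA.
by apply: KM => //; apply: abq_comm => //; apply: KH.
Qed.

Lemma lcoset_mem x y : lcoset K x y <-> K (x^-1 * y).
Proof.
split=> [[k Kk <-]|Kxy]; first by rewrite mulKg.
by exists (x^-1 * y) => //; rewrite mulVKg.
Qed.

Lemma lcoset_eq x y : lcoset K x = lcoset K y <-> K (x^-1 * y).
Proof.
split=> [E|Kxy]; first by apply/lcoset_mem; rewrite E; exists 1; rewrite ?mulg1.
apply/seteqP; split=> z /lcoset_mem Kz; apply/lcoset_mem.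
  have -> : y^-1 * z = (x^-1 * y)^-1 * (x^-1 * z).
    by rewrite invgM invgK -mulgA mulVKg.
  by apply: KM => //; apply: KV.
have -> : x^-1 * z = (x^-1 * y) * (y^-1 * z) by rewrite -mulgA mulVKg.
exact: KM.
Qed.

Lemma setmul_lcoset x y : H y ->
  setmul (lcoset K x) (lcoset K y) = lcoset K (x * y).
Proof.
move=> Hy; apply/seteqP; split.
  move=> _ [_ [a Ka <-] [_ [b Kb <-] <-]].
  exists (y^-1 * a * y * b); first by apply: KM => //; apply: KJ.
  by rewrite !mulgA mulgK.
move=> _ [a Ka <-]; exists x; first by exists 1; rewrite ?mulg1.
by exists (y * a); [exists a|rewrite mulgA].
Qed.

Lemma setinv_lcoset x : H x ->
  [set z^-1 | z in lcoset K x] = lcoset K x^-1.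
Proof.
move=> Hx; apply/seteqP; split.
  move=> _ [_ [a Ka <-] <-]; apply/lcoset_mem; rewrite invgK invgM mulgA.
  have := KJ (HV Hx) (KV Ka); by rewrite invgK.
move=> _ [a Ka <-]; exists (a^-1 * x); last by rewrite invgM invgK.
by apply/lcoset_mem; rewrite mulgA; apply: KJ => //; apply: KV.
Qed.

Lemma abq_mk_subproof x : H x -> lcoset K x \in cosets H K.
Proof. by move=> Hx; rewrite inE; exists x. Qed.

Definition abq_mk x (Hx : H x) : abq := Abq (abq_mk_subproof Hx).

Lemma abqP (C : abq) : exists x, exists Hx : H x, C = abq_mk Hx.
Proof.
case: C => C CP; have := CP; rewrite inE => -[x Hx E].
by exists x, Hx; apply: val_inj.
Qed.

Lemma abq_add_subproof (C D : abq) : setmul (val C) (val D) \in cosets H K.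
Proof.
have [[x [Hx ->]] [y [Hy ->]]] := (abqP C, abqP D).
by rewrite /= setmul_lcoset // inE; exists (x * y) => //; apply: HM.
Qed.

Lemma abq_opp_subproof (C : abq) : [set z^-1 | z in val C] \in cosets H K.
Proof.
have [x [Hx ->]] := abqP C.
by rewrite /= setinv_lcoset // inE; exists x^-1 => //; apply: HV.
Qed.

Definition abq_zero : abq := abq_mk H1.
Definition abq_add (C D : abq) : abq := Abq (abq_add_subproof C D).
Definition abq_opp (C : abq) : abq := Abq (abq_opp_subproof C).

Lemma abq_addA : associative abq_add.
Proof.
move=> C D E; have [[x [Hx ->]] [y [Hy ->]]] := (abqP C, abqP D).
have [z [Hz ->]] := abqP E; apply: val_inj => /=.
by rewrite !setmul_lcoset ?mulgA //; apply: HM.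
Qed.

Lemma abq_addC : commutative abq_add.
Proof.
move=> C D; have [[x [Hx ->]] [y [Hy ->]]] := (abqP C, abqP D).
apply: val_inj => /=; rewrite !setmul_lcoset //; apply/lcoset_eq.
have -> : (x * y)^-1 * (y * x) = [~ y, x].
  by rewrite /commg /conjg invgM -mulgA.
exact: abq_comm.
Qed.

Lemma abq_add0 : left_id abq_zero abq_add.
Proof.
by move=> C; have [x [Hx ->]] := abqP C; apply: val_inj; rewrite /= setmul_lcoset ?mul1g.
Qed.

Lemma abq_addN : left_inverse abq_zero abq_opp abq_add.
Proof.
move=> C; have [x [Hx ->]] := abqP C; apply: val_inj.
by rewrite /= setinv_lcoset // setmul_lcoset // mulVg.
Qed.

HB.instance Definition _ :=
  GRing.isZmodule.Build abq abq_addA abq_addC abq_add0 abq_addN.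

End AbelianQuotient.

Section CentralSeriesQuotient.
Variable G : groupType.
Implicit Types N S : set G.

Lemma generated_subgroup S : is_subgroup (generated S).
Proof.
split=> [M [[]]//|x y Sx Sy M MP|x Sx M MP]; have [[_ MM MV] _] := MP.
- by apply: MM; [apply: Sx|apply: Sy].
- by apply: MV; apply: Sx.
Qed.

Lemma lcs_subgroup N n : is_subgroup N -> is_subgroup (lcs N n).
Proof. by case: n => [|n] // _; apply: generated_subgroup. Qed.

Lemma lcs_commg N n x y : lcs N n x -> N y -> lcs N n.+1 [~ x, y].
Proof. by move=> Nx Ny; apply: sub_gen_smallest; exists x => //; exists y. Qed.

Lemma lcs_sub N n : is_subgroup N -> lcs N n `<=` N.
Proof.
move=> NP; elim: n => [//|n IHn]; apply: smallest_sub => // _ [x Nx [y Ny <-]].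
have [_ NM NV] := NP; have {}Nx := IHn _ Nx.
exact: NM _ _ (NV _ Nx) (NM _ _ (NV _ Ny) (NM _ _ Nx Ny)).
Qed.

Lemma lcsS_sub N n : is_subgroup N -> lcs N n.+1 `<=` lcs N n.
Proof.
move=> NP; elim: n => [|n IHn]; first exact: (@lcs_sub N 1).
apply: smallest_sub; first exact: lcs_subgroup.
by move=> _ [x Nx [y Ny <-]]; apply: lcs_commg => //; apply: IHn.
Qed.

Lemma lcs_comm N n x y : is_subgroup N ->
  lcs N n x -> lcs N n y -> lcs N n.+1 [~ x, y].
Proof. by move=> NP Nx /(lcs_sub NP); apply: lcs_commg. Qed.

(* The section N_{n+1} / N_{n+2} of the descending central series. *)
Definition lcs_section N (NP : is_subgroup N) (n : nat) : abelian_section G :=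
  AbelianSection (lcs_subgroup n NP) (lcs_subgroup n.+1 NP)
    (@lcsS_sub N n NP) (fun x y => @lcs_comm N n x y NP).

End CentralSeriesQuotient.

Local Open Scope ring_scope.
Local Open Scope quotient_scope.

Section TensorQ.
Variable A : zmodType.

(* The formal sum of the symbols q (x) a, for (q, a) in the sequence. Modulo
   the relations below it becomes a group without adjoining inverses, because
   (- q) (x) a is then inverse to q (x) a. *)
Definition formal_sum : Type := seq (rat * A).
HB.instance Definition _ := Choice.on formal_sum.

Inductive tensorQ_rel : formal_sum -> formal_sum -> Prop :=
| TQrefl s : tensorQ_rel s s
| TQsym s t : tensorQ_rel s t -> tensorQ_rel t s
| TQtrans s t u : tensorQ_rel s t -> tensorQ_rel t u -> tensorQ_rel s u
| TQcat s s' t t' :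
    tensorQ_rel s s' -> tensorQ_rel t t' -> tensorQ_rel (s ++ t) (s' ++ t')
| TQcomm s t : tensorQ_rel (s ++ t) (t ++ s)
| TQ0 a : tensorQ_rel [:: (0, a)] [::]
| TQDl p q a : tensorQ_rel [:: (p + q, a)] [:: (p, a); (q, a)]
| TQDr q a b : tensorQ_rel [:: (q, a + b)] [:: (q, a); (q, b)].

Definition tensorQ_relb (s t : formal_sum) : bool := `[< tensorQ_rel s t >].

Lemma tensorQ_relb_equiv : equiv_class_of tensorQ_relb.
Proof.
split=> [s|s t|t s u].
- by apply/asboolP; apply: TQrefl.
- by apply/asboolP/asboolP; apply: TQsym.
- by move=> /asboolP st /asboolP tu; apply/asboolP; apply: TQtrans tu.
Qed.

Canonical tensorQ_equiv := EquivRelPack tensorQ_relb_equiv.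

(* The tensor product of Q and A over Z. *)
Definition tensorQ : Type := {eq_quot tensorQ_relb}.
HB.instance Definition _ := Choice.on tensorQ.
HB.instance Definition _ := EqQuotient.on tensorQ.

Definition tensorQ_mk (s : formal_sum) : tensorQ := \pi_tensorQ s.

Lemma tensorQ_mkP s t : tensorQ_mk s = tensorQ_mk t <-> tensorQ_rel s t.
Proof.
by split=> [/eqP|st]; [rewrite eqmodE => /asboolP|apply/eqP; rewrite eqmodE; apply/asboolP].
Qed.

Lemma tensorQ_mkK (x : tensorQ) : tensorQ_mk (repr x) = x.
Proof. exact: reprK. Qed.

Lemma tensorQ_repr s : tensorQ_rel (repr (tensorQ_mk s)) s.
Proof. by apply/tensorQ_mkP; rewrite tensorQ_mkK. Qed.

Definition tensorQ_zero : tensorQ := tensorQ_mk [::].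
Definition tensorQ_add (x y : tensorQ) : tensorQ := tensorQ_mk (repr x ++ repr y).
Definition tensorQ_scale (c : rat) (x : tensorQ) : tensorQ :=
  tensorQ_mk [seq (c * u.1, u.2) | u <- repr x].
Definition tensorQ_opp (x : tensorQ) : tensorQ := tensorQ_scale (-1) x.

Lemma tensorQ_addE s t :
  tensorQ_add (tensorQ_mk s) (tensorQ_mk t) = tensorQ_mk (s ++ t).
Proof. by apply/tensorQ_mkP; apply: TQcat; apply: tensorQ_repr. Qed.

Lemma tensorQ_rel_scale c s t : tensorQ_rel s t ->
  tensorQ_rel [seq (c * u.1, u.2) | u <- s] [seq (c * u.1, u.2) | u <- t].
Proof.
elim=> {s t} [s|s t _ IH|s t u _ IH1 _ IH2|s s' t t' _ IH1 _ IH2|s t|a|p q a|q a b] /=.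
- exact: TQrefl.
- exact: TQsym.
- exact: TQtrans IH1 IH2.
- by rewrite !map_cat; apply: TQcat.
- by rewrite !map_cat; apply: TQcomm.
- by rewrite mulr0; apply: TQ0.
- by rewrite mulrDr; apply: TQDl.
- exact: TQDr.
Qed.

Lemma tensorQ_scaleE c s :
  tensorQ_scale c (tensorQ_mk s) = tensorQ_mk [seq (c * u.1, u.2) | u <- s].
Proof. by apply/tensorQ_mkP; apply: tensorQ_rel_scale; apply: tensorQ_repr. Qed.

Lemma tensorQ_addA : associative tensorQ_add.
Proof.
move=> x y z; rewrite -(tensorQ_mkK x) -(tensorQ_mkK y) -(tensorQ_mkK z).
by rewrite !tensorQ_addE catA.
Qed.

Lemma tensorQ_addC : commutative tensorQ_add.
Proof. by move=> x y; apply/tensorQ_mkP; apply: TQcomm. Qed.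

Lemma tensorQ_add0 : left_id tensorQ_zero tensorQ_add.
Proof. by move=> x; rewrite -(tensorQ_mkK x) tensorQ_addE. Qed.

Lemma tensorQ_rel_scaleD c d s :
  tensorQ_rel [seq ((c + d) * u.1, u.2) | u <- s]
    ([seq (c * u.1, u.2) | u <- s] ++ [seq (d * u.1, u.2) | u <- s]).
Proof.
elim: s => [|[q a] s IHs] /=; first exact: TQrefl.
rewrite mulrDl; apply: TQtrans (TQcat (TQDl _ _ _) IHs) _.
apply: (@TQcat [:: (c * q, a)] [:: (c * q, a)]); first exact: TQrefl.
have := TQcat (TQcomm [:: (d * q, a)] [seq (c * u.1, u.2) | u <- s])
  (TQrefl [seq (d * u.1, u.2) | u <- s]).
by rewrite -!catA.
Qed.

Lemma tensorQ_scale0 x : tensorQ_scale 0 x = tensorQ_zero.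
Proof.
rewrite -(tensorQ_mkK x) tensorQ_scaleE; apply/tensorQ_mkP.
elim: (repr x) => [|[q a] s IHs] /=; first exact: TQrefl.
by rewrite mul0r; apply: (TQcat (TQ0 a) IHs).
Qed.

Lemma tensorQ_scaleA c d x :
  tensorQ_scale c (tensorQ_scale d x) = tensorQ_scale (c * d) x.
Proof.
rewrite -(tensorQ_mkK x) !tensorQ_scaleE -map_comp; congr tensorQ_mk.
by apply: eq_map => u /=; rewrite mulrA.
Qed.

Lemma tensorQ_scale1 : left_id 1 tensorQ_scale.
Proof.
move=> x; rewrite -(tensorQ_mkK x) tensorQ_scaleE; congr tensorQ_mk.
by rewrite -[RHS]map_id; apply: eq_map => -[q a] /=; rewrite mul1r.
Qed.

Lemma tensorQ_scaleDl x c d :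
  tensorQ_scale (c + d) x = tensorQ_add (tensorQ_scale c x) (tensorQ_scale d x).
Proof.
rewrite -(tensorQ_mkK x) !tensorQ_scaleE tensorQ_addE.
by apply/tensorQ_mkP; apply: tensorQ_rel_scaleD.
Qed.

Lemma tensorQ_scaleDr : right_distributive tensorQ_scale tensorQ_add.
Proof.
move=> c x y; rewrite -(tensorQ_mkK x) -(tensorQ_mkK y).
by rewrite !(tensorQ_addE, tensorQ_scaleE) map_cat.
Qed.

Lemma tensorQ_addN : left_inverse tensorQ_zero tensorQ_opp tensorQ_add.
Proof.
by move=> x; rewrite -[X in tensorQ_add _ X]tensorQ_scale1 -tensorQ_scaleDl addNr tensorQ_scale0.
Qed.

HB.instance Definition _ := GRing.isZmodule.Build tensorQ
  tensorQ_addA tensorQ_addC tensorQ_add0 tensorQ_addN.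

HB.instance Definition _ := GRing.Zmodule_isLmodule.Build rat tensorQ
  tensorQ_scaleA tensorQ_scale1 tensorQ_scaleDr
  (fun x c d => tensorQ_scaleDl x c d).

End TensorQ.

Definition has_dim (V : lmodType rat) (r : nat) : Prop :=
  exists e : 'I_r -> V, forall v : V,
    exists! c : {ffun 'I_r -> rat}, v = \sum_i c i *: e i.

(* 0 when V has infinite dimension. *)
Definition dimQ (V : lmodType rat) : nat := xget 0%N [set r | has_dim V r].

Definition zrank (A : zmodType) : nat := dimQ (tensorQ A).

(* Rk_n(N) for n >= 1; [n.-1] accounts for the index shift of [lcs]. *)
Definition Rk (G : groupType) (N : set G) (NP : is_subgroup N) (n : nat) : nat :=
  zrank (abq (lcs_section NP n.-1)).

(* The sum has finite support when N is nilpotent. *)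
Definition homogeneous_dim (G : groupType) (N : set G) (NP : is_subgroup N) : nat :=
  (\big[addn/0]_(n \in [set n | 1 <= n]) (n * Rk NP n))%N.

(* k = d(G), computed from a nilpotent subgroup of finite index; the value
   does not depend on this subgroup. *)
Definition growth_degree (G : groupType) (k : nat) : Prop :=
  exists (N : set G) (NP : is_subgroup N),
    [/\ is_nilpotent N, finite_index N & k = homogeneous_dim NP].

Section LargeScalePacking.
Local Open Scope group_scope.
Variable G : groupType.

Definition LSP_admissible (d m : nat) : Prop :=
  forall L : set G, finite_set L ->
  exists N : set G,
    [/\ finite_set N, N 1, [set x^-1 | x in N] = N &
      forall (n : nat) (g : 'I_n -> G), (m < n)%N ->
        (forall i, setmul N L (g i)) ->
        exists F : {set 'I_n}, (d + 1 < #|F|)%N /\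
          {in F &, forall i j, N (g i * (g j)^-1)}].

End LargeScalePacking.

(* Valued in the extended reals: it is +oo when no m is admissible. *)
Definition LSP (R : realType) (d : nat) (G : groupType) : \bar R :=
  ereal_inf [set (m%:R)%:E | m in LSP_admissible G d].

(* Main.v *)
(* By a volume argument, it is enough to bound the growth of balls. If [S] is a
   finite symmetric set containing [1] and [L], take [N = S ^ (2 r)]. For
   [g_1, ..., g_n] in [N L] the sets [S ^ r g_i] lie in [S ^ (3 r + 1)], so when
   [n |S ^ r| > (d + 1) |S ^ (3 r + 1)|] some point lies in more than [d + 1] of
   them, and then the quotients of the corresponding [g_i] lie in [N]. With
   [n > 3 ^ k (d + 1)] such an [r] exists as soon as [|S ^ r| = O(r ^ k)].

   This bound is the upper half of the theorem of Bass and Guivarc'h. Give the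
   elements of [N_i] weight [i], and consider the elements represented by words
   with [O(n ^ i)] letters of weight [i] for each [i]. Collecting a letter of
   weight [j] to the left only creates commutators of higher weight, and preserves
   the bounds. Modulo [N_(j+1)], letters of weight [j] reduce to powers of [Rk_j]
   generators with exponents [O(n ^ j)], up to a bounded number of choices, so
   that the layer [j] contributes a factor [O(n ^ (j Rk_j))]. *)
Require Import Defs.
From HB Require Import structures.
From mathcomp Require Import all_boot all_order all_algebra.
From mathcomp Require Import boolp classical_sets cardinality fsbigop.
From mathcomp Require Import reals ereal.
From mathcomp Require Import zify.

Set Implicit Arguments.
Unset Strict Implicit.
Unset Printing Implicit Defensive.

Import Order.TTheory GRing.Theory Num.Theory.

Local Open Scope classical_set_scope.

(** * The lower central series *)

Section GroupIdentities.
Local Open Scope group_scope.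
Variable G : groupType.
Implicit Types x y z : G.

Lemma commgMr x y z : [~ x, y * z] = [~ x, z] * [~ x, y] ^ z.
Proof. by rewrite /commg /conjg !gnorm. Qed.

Lemma commMgr x y z : [~ x * y, z] = [~ x, z] ^ y * [~ y, z].
Proof. by rewrite /commg /conjg !gnorm. Qed.

Lemma commgVr x y : [~ x, y^-1] = ([~ x, y] ^ y^-1)^-1.
Proof. by rewrite /commg /conjg !gnorm. Qed.

Lemma commVgr x y : [~ x^-1, y] = ([~ x, y] ^ x^-1)^-1.
Proof. by rewrite /commg /conjg !gnorm. Qed.

Lemma conjg_commg x y : x ^ y = x * [~ x, y].
Proof. by rewrite commgEl mulVKg. Qed.

Lemma Hall_Witt x y z :
  [~ x, y^-1, z] ^ y * [~ y, z^-1, x] ^ z * [~ z, x^-1, y] ^ x = 1.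
Proof. by rewrite /commg /conjg !gnorm. Qed.

Variable H : set G.
Hypothesis HP : is_subgroup H.

Lemma subgroup1 : H 1. Proof. by case: HP. Qed.
Lemma subgroupM x y : H x -> H y -> H (x * y).
Proof. by case: HP => _ + _; apply. Qed.
Lemma subgroupV x : H x -> H x^-1.
Proof. by case: HP => _ _; apply. Qed.
Lemma subgroupX x n : H x -> H (x ^+ n).
Proof.
move=> Hx; elim: n => [|n IH]; first by rewrite expg0; exact: subgroup1.
by rewrite expgS; apply: subgroupM.
Qed.
Lemma subgroupJ x y : H x -> H y -> H (x ^ y).
Proof. by move=> Hx Hy; rewrite conjgE; apply/subgroupM/subgroupM => //; apply: subgroupV. Qed.

End GroupIdentities.

Section LowerCentralSeries.
Local Open Scope group_scope.
Variables (G : groupType) (N : set G).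
Hypothesis NP : is_subgroup N.
Implicit Types x y z : G.
Local Notation L := (lcs N).

Let LP n : is_subgroup (L n) := lcs_subgroup n NP.

Lemma mem_generated (S : set G) x : S x -> generated S x.
Proof. exact: sub_gen_smallest. Qed.

Lemma generated_sub (S H : set G) : is_subgroup H -> S `<=` H -> generated S `<=` H.
Proof. by move=> HP SH; apply: smallest_sub. Qed.

Lemma lcsJ n x y : L n x -> N y -> L n (x ^ y).
Proof.
move=> Lx Ny; rewrite conjg_commg; apply: (subgroupM (LP _)) => //.
by apply: lcsS_sub => //; apply: lcs_commg.
Qed.

(** With indices starting at 1 this reads $[N_p, N_q] \subseteq N_{p+q}$ for $p = i+1$, $q = j+1$.
    By the commutator identities the [y] that satisfy it for all [x] form a subgroup [M], so only
    the generators [[~ u, v]] of [L j.+1] have to be checked. *)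
Lemma lcs_commg_add i j x y : L i x -> L j y -> L (i + j).+1 [~ x, y].
Proof.
elim: j i x y => [|j IH] i x y Lx Ly; first by rewrite addn0; apply: lcs_commg.
have Nsub n : L n `<=` N by exact: lcs_sub.
pose M := [set y | N y /\ forall x, L i x -> L (i + j.+1).+1 [~ x, y]].
suff : M y by case=> _; apply.
move: y Ly; apply: generated_sub => [|_ [u Lu [v Nv <-]]].
  split=> [|a b [Na Ha] [Nb Hb]|a [Na Ha]].
  - by split=> [|z _]; [apply: subgroup1|rewrite commg1; apply: (subgroup1 (LP _))].
  - split=> [|z Lz]; first exact: subgroupM.
    by rewrite commgMr; apply: (subgroupM (LP _)); [apply: Hb|apply: lcsJ => //; apply: Ha].
  - split=> [|z Lz]; first exact: subgroupV.
    by rewrite commgVr; apply/(subgroupV (LP _))/lcsJ; [apply: Ha|apply: subgroupV].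
split=> [|z Lz].
  have Nu := Nsub _ _ Lu.
  by rewrite commgEl; apply: subgroupM => //; [apply: subgroupV|apply: subgroupJ].
have Nz := Nsub _ _ Lz; have Nu := Nsub _ _ Lu.
(* The three subgroups lemma. *)
rewrite -invgR; apply: (subgroupV (LP _)).
have := Hall_Witt u v^-1 z; rewrite invgK => HW.
have -> : [~ u, v, z] =
  (([~ v^-1, z^-1, u] ^ z * [~ z, u^-1, v^-1] ^ u)^-1) ^ v.
  rewrite -[LHS](conjgKV v); congr (_ ^ v).
  by apply: (mulIg ([~ v^-1, z^-1, u] ^ z * [~ z, u^-1, v^-1] ^ u)); rewrite mulVg mulgA.
apply: lcsJ => //; apply: (subgroupV (LP _)); apply: (subgroupM (LP _)).
  apply: lcsJ => //; rewrite addnS -addSn; apply: IH => //.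
  rewrite -invgR; apply: (subgroupV (LP _)).
  by apply: lcs_commg; [apply: (subgroupV (LP _))|apply: subgroupV].
apply: lcsJ => //; rewrite addnS; apply: lcs_commg; last exact: subgroupV.
by apply: IH => //; apply: (subgroupV (LP _)).
Qed.

(** The commutator map from [L n] and [N] to [L n.+1] is bilinear modulo [L n.+2], so the
    commutators of generators suffice. Linearity is used first in [y], through [M], and then in [z],
    through [M']; the conjugates in the identities stay in [generated S] because it contains
    [L n.+2]. *)
Lemma lcs_fg_mod (s : seq G) n : generated [set` s] = N ->
  exists2 F : seq G, {in F, forall x, L n x} &
    L n = generated ([set` F] `|` L n.+1).
Proof.
move=> sN; elim: n => [|n [F FL FE]].
  exists s => [x xs|]; first by rewrite /= -sN; apply: mem_generated.
  apply/seteqP; split.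
    by rewrite /= -sN; apply: generated_sub;
      [apply: generated_subgroup|move=> x xs; apply: mem_generated; left].
  apply: generated_sub => //; move=> x [xs|]; last exact: (lcsS_sub NP).
  by rewrite /= -sN; apply: mem_generated.
have sNx x : x \in s -> N x by move=> xs; rewrite -sN; apply: mem_generated.
exists [seq [~ x, y] | x <- F, y <- s].
  by move=> _ /allpairsP[[x y] /= [xF ys ->]]; apply: lcs_commg; [apply: FL|apply: sNx].
set S := _ `|` _.
have HP : is_subgroup (generated S) by exact: generated_subgroup.
have SL : generated S `<=` L n.+1.
  apply: generated_sub => // x [|]; last exact: (lcsS_sub NP).
  by move=> /allpairsP[[x1 y1] /= [xF ys ->]]; apply: lcs_commg; [apply: FL|apply: sNx].
have LS x : L n.+2 x -> generated S x by move=> Lx; apply: mem_generated; right.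
have SJ x y : generated S x -> N y -> generated S (x ^ y).
  by move=> Sx Ny; rewrite conjg_commg; apply: (subgroupM HP) => //; apply: LS;
    apply: lcs_commg => //; apply: SL.
apply/seteqP; split=> //; apply: generated_sub => // _ [x Lx [y Ny <-]].
pose M := [set y | N y /\ forall x, L n x -> generated S [~ x, y]].
suff : N `<=` M by move=> /(_ _ Ny)[_]; apply.
rewrite -[X in X `<=` _]sN; move=> {x Lx y Ny}; apply: generated_sub => [|y ys].
  split=> [|a b [Na Ha] [Nb Hb]|a [Na Ha]].
  - by split=> [|z _]; [apply: subgroup1|rewrite commg1; apply: (subgroup1 HP)].
  - split=> [|z Lz]; first exact: (subgroupM NP).
    by rewrite commgMr; apply: (subgroupM HP); [apply: Hb|apply: SJ => //; apply: Ha].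
  - split=> [|z Lz]; first exact: (subgroupV NP).
    by rewrite commgVr; exact: (subgroupV HP (SJ _ _ (Ha _ Lz) (subgroupV NP Na))).
have Ny : N y by exact: sNx.
split=> // z Lz.
pose M' := [set z | L n z /\ generated S [~ z, y]].
suff : L n `<=` M' by move=> /(_ _ Lz)[].
rewrite [X in X `<=` _]FE; move=> {z Lz}; apply: generated_sub => [|z [zF|Lz]].
  split=> [|a b [La Ha] [Lb Hb]|a [La Ha]].
  - by split; [apply: (subgroup1 (LP _))|rewrite comm1g; apply: (subgroup1 HP)].
  - split; first exact: (subgroupM (LP _)).
    by rewrite commMgr; apply: (subgroupM HP) => //; apply: SJ => //; apply: lcs_sub Lb.
  - split; first exact: (subgroupV (LP _)).
    by rewrite commVgr; exact: (subgroupV HP (SJ _ _ Ha (subgroupV NP (lcs_sub NP La)))).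
- split; first exact: FL.
  by apply: mem_generated; left; apply/allpairsP; exists (z, y).
- split; first exact: (lcsS_sub NP).
  by apply: LS; apply: lcs_commg.
Qed.

Lemma lcs_trivial c m : L c = [set 1] -> c <= m -> L m = [set 1].
Proof.
move=> Lc /subnK <-; elim: (m - c)%N => [//|i IH].
apply/seteqP; split; last by move=> _ ->; apply: (subgroup1 (LP _)).
by rewrite addSn -[X in _ `<=` X]IH; apply: lcsS_sub.
Qed.

End LowerCentralSeries.

(** * Collection and counting *)

(** Bernoulli's inequality $(1 - 1/(M+1))^e \geq 1 - e/(M+1)$ without denominators. Truncated
    subtraction makes it trivial for [e] above [M]. *)
Lemma bernoulli_succ M e : (M.+1 - e) * M.+1 ^ e <= M.+1 * M ^ e.
Proof.
elim: e => [|e IH]; first by rewrite subn0 !expn0.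
have [le_eM|lt_Me] := leqP e M; last by have -> : M.+1 - e.+1 = 0 by lia.
have H : (M.+1 - e.+1) * M.+1 <= (M.+1 - e) * M by nia.
rewrite !expnS mulnA; apply: leq_trans (leq_mul H (leqnn _)) _.
by rewrite mulnAC mulnCA mulnC leq_mul.
Qed.

Lemma leq_exp_base m n e : m <= n -> m ^ e <= n ^ e.
Proof. by case: e => // e mn; rewrite leq_exp2r. Qed.

(** This is $(1 + 1/M)^e \leq 4^C$. For [h] equal to half of [M] rounded up, Bernoulli's inequality
    gives $(1 + 1/M)^h \leq 2$; squaring yields the factor 4 for the exponent $2h \geq M$, and [C]
    such blocks cover [e]. *)
Lemma expSn_le4 M C e : 0 < M -> e <= C * M -> M.+1 ^ e <= 4 ^ C * M ^ e.
Proof.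
move=> M0 eCM; pose h := uphalf M.
have hM : M <= h.*2 <= M.+1 by rewrite /h uphalf_half; have := odd_double_half M; case: (odd M);
  lia.
have H1 : M.+1 ^ h <= 2 * M ^ h.
  have B := bernoulli_succ M h.
  rewrite -(@leq_pmul2l M.+1) //; apply: leq_trans (_ : (2 * (M.+1 - h)) * M.+1 ^ h <= _).
    by rewrite leq_mul2r; lia.
  by rewrite mulnCA -mulnA leq_mul2l B.
have H2 : M.+1 ^ h.*2 <= 4 * M ^ h.*2.
  rewrite -addnn !expnD; apply: leq_trans (leq_mul H1 H1) _.
  by rewrite mulnACA.
have H3 : M.+1 ^ (h.*2 * C) <= 4 ^ C * M ^ (h.*2 * C).
  by rewrite !expnM -expnMn leq_exp_base.
have le_e : e <= h.*2 * C by nia.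
rewrite -(@leq_pmul2r (M ^ (h.*2 * C - e))) ?expn_gt0 ?M0 //.
rewrite -mulnA -expnD subnKC //; apply: leq_trans H3.
rewrite -[X in _ <= _ ^ X](subnKC le_e) expnD leq_mul2l.
by apply/orP; right; apply: leq_exp_base.
Qed.

Section Collection.
Variables (G : groupType) (Gam : nat -> set G) (c : nat).
Hypothesis GamP : forall i, is_subgroup (Gam i).
Hypothesis Gam_comm : forall i j x y, 0 < i -> 0 < j ->
  Gam i x -> Gam j y -> Gam (i + j) [~ x, y]%g.
Hypothesis Gam_triv : forall i x, c < i -> Gam i x -> x = 1%g.

Definition letter : Type := (nat * G)%type.
HB.instance Definition _ := Choice.on letter.
Implicit Types (p q x : letter) (u w A B : seq letter) (n C : nat).

Definition in_filtration p : Prop := 0 < p.1 /\ Gam p.1 p.2.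

Definition word_val w : G := (\prod_(p <- w) p.2)%g.

(* Up to constants, [mass n w <= C * n ^ c] says that every letter of weight [i]
   occurs [O(n ^ i)] times in [w]; unlike these counts, [mass] only gets multiplied
   by [1 + n ^ - j] when [w] is conjugated by a letter of weight [j]. *)
Definition mass n w : nat := \sum_(p <- w) n ^ (c - p.1).

Definition bracket x p : letter := (p.1 + x.1, [~ p.2, x.2]%g).

(* From [t ^ x = t * [~ t, x]]; letters of weight above [c] have a trivial value
   and are dropped. *)
Definition conjw x w : seq letter :=
  flatten [seq p :: (if p.1 + x.1 <= c then [:: bracket x p] else [::]) | p <- w].

(** All occurrences of [x] are moved to the front; the result is their number and the remaining
    word. By [p * x ^ e = x ^ e * p ^ (x ^ e)], a letter [p] is conjugated once for each [x] to its
    right. *)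
Fixpoint collect x w : nat * seq letter :=
  if w is p :: w' then
    let: (e, u) := collect x w' in
    if p == x then (e.+1, u) else (e, iter e (conjw x) [:: p] ++ u)
  else (0, [::]).

Lemma word_val_cat w u : word_val (w ++ u) = (word_val w * word_val u)%g.
Proof. exact: big_cat. Qed.

Lemma word_val_cons p w : word_val (p :: w) = (p.2 * word_val w)%g.
Proof. exact: big_cons. Qed.

Lemma mass_cat n w u : mass n (w ++ u) = mass n w + mass n u.
Proof. exact: big_cat. Qed.

Lemma mass_cons n p w : mass n (p :: w) = n ^ (c - p.1) + mass n w.
Proof. exact: big_cons. Qed.

Lemma conjw_cons x p w : conjw x (p :: w) = conjw x [:: p] ++ conjw x w.
Proof. by rewrite /conjw /= cats0. Qed.

Lemma in_filtration_bracket x p :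
  in_filtration x -> in_filtration p -> in_filtration (bracket x p).
Proof.
move=> [x0 Gx] [p0 Gp]; split; first by rewrite /= addn_gt0 p0.
exact: Gam_comm.
Qed.

Lemma in_filtration_conjw x w : in_filtration x ->
  {in w, forall p, in_filtration p} -> {in conjw x w, forall p, in_filtration p}.
Proof.
move=> fx fw q /flattenP[_ /mapP[p pw ->]]; rewrite inE => /orP[/eqP->|]; first exact: fw.
by case: ifP => // _; rewrite inE => /eqP ->; apply: in_filtration_bracket => //; apply: fw.
Qed.

Lemma word_val_conjw x w : in_filtration x -> {in w, forall p, in_filtration p} ->
  word_val (conjw x w) = (word_val w ^ x.2)%g.
Proof.
move=> fx; elim: w => [|p w IH] fw; first by rewrite /word_val big_nil conj1g.
rewrite conjw_cons word_val_cat word_val_cons conjMg IH; last first.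
  by move=> q qw; apply: fw; rewrite inE qw orbT.
congr (_ * _)%g; rewrite /conjw /= cats0 conjg_commg word_val_cons; congr (_ * _)%g.
case: ifP => [_|/negbT]; first by rewrite /word_val big_seq1.
rewrite -ltnNge => lt_c; rewrite /word_val big_nil.
have [|_ G1] := @in_filtration_bracket x p fx; first by apply: fw; rewrite mem_head.
exact: esym (Gam_triv lt_c G1).
Qed.

Lemma iter_conjw x w e : in_filtration x -> {in w, forall p, in_filtration p} ->
  {in iter e (conjw x) w, forall p, in_filtration p} /\
  word_val (iter e (conjw x) w) = (word_val w ^ (x.2 ^+ e))%g.
Proof.
move=> fx fw; elim: e => [|e [IH1 IH2]] /=; first by rewrite expg0 conjg1.
split; first exact: in_filtration_conjw.
by rewrite word_val_conjw // IH2 -conjgM expgSr.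
Qed.

Lemma word_val_collect x w : in_filtration x -> {in w, forall p, in_filtration p} ->
  word_val w = (x.2 ^+ (collect x w).1 * word_val (collect x w).2)%g.
Proof.
move=> fx; elim: w => [|p w IH] fw /=; first by rewrite /word_val big_nil expg0 mulg1.
have {}IH := IH (fun q qw => fw q (mem_behead (s := p :: w) qw)).
rewrite word_val_cons IH; case: (collect x w) => e u /=.
case: eqP => [->|_] /=; first by rewrite expgS mulgA.
have fp : {in [:: p], forall q, in_filtration q}.
  by move=> q; rewrite inE => /eqP->; apply: fw; rewrite mem_head.
rewrite word_val_cat (iter_conjw e fx fp).2.
by rewrite /word_val big_seq1 [RHS]mulgA -conjgC mulgA.
Qed.

Lemma mass_conjw n x w : 0 < n -> n ^ x.1 * mass n (conjw x w) <= (n ^ x.1).+1 * mass n w.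
Proof.
move=> n0; elim: w => [|p w IH]; first by rewrite /mass big_nil !muln0.
rewrite conjw_cons mass_cat mass_cons !mulnDr leq_add // /conjw /= cats0 mass_cons mulnDr.
rewrite mulSn addnC leq_add2r; case: ifP => [le_c|_]; last by rewrite /mass big_nil muln0.
by rewrite /mass big_seq1 -expnD leq_eqVlt /=; apply/orP; left; apply/eqP; congr (_ ^ _); lia.
Qed.

Lemma mass_iter_conjw n x w e : 0 < n ->
  (n ^ x.1) ^ e * mass n (iter e (conjw x) w) <= (n ^ x.1).+1 ^ e * mass n w.
Proof.
move=> n0; elim: e => [//|e IH]; rewrite iterS.
rewrite !expnS [n ^ x.1 * _]mulnC -mulnA.
apply: leq_trans (leq_mul (leqnn ((n ^ x.1) ^ e)) (mass_conjw x _ n0)) _.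
by rewrite mulnCA -mulnA leq_mul2l IH orbT.
Qed.


Lemma collect_count n x w : (collect x w).1 * n ^ (c - x.1) <= mass n w.
Proof.
elim: w => [|p w IH] //=; rewrite mass_cons.
case: (collect x w) IH => e u /= IH; case: eqP => [->|_] /=; first by rewrite mulSn leq_add2l.
exact: leq_trans IH (leq_addl _ _).
Qed.

(** Each letter is conjugated at most [C * n ^ x.1] times, and each conjugation multiplies the mass
    by at most $1 + n^{-j}$, where [j] is the weight of [x]; [expSn_le4] with [M = n ^ x.1] bounds
    the product of these factors. *)
Lemma mass_collect n C x w : 0 < n -> (collect x w).1 <= C * n ^ x.1 ->
  mass n (collect x w).2 <= 4 ^ C * mass n w.
Proof.
move=> n0; elim: w => [|p w IH] /=; first by rewrite /mass big_nil.
case: (collect x w) IH => e u /= IH; rewrite mass_cons; case: eqP => [_|_] /= le_e.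
  by apply: leq_trans (IH (ltnW le_e)) _; rewrite leq_mul2l leq_addl orbT.
rewrite mass_cat mulnDr; apply: leq_add; last exact: IH.
have nx : 0 < n ^ x.1 by rewrite expn_gt0 n0.
rewrite -(@leq_pmul2l ((n ^ x.1) ^ e)) ?expn_gt0 ?n0 //.
apply: leq_trans (mass_iter_conjw x _ e n0) _.
rewrite mass_cons /mass big_nil addn0 mulnA leq_mul2r; apply/orP; right.
by rewrite mulnC; apply: expSn_le4.
Qed.

(** Only the iterated brackets [[p, x, ..., x]] of weight at most [c] appear, so the alphabet needed
    after collection is finite and does not depend on [e]. *)
Lemma mem_iter_conjw x p e q : p.1 <= c -> q \in iter e (conjw x) [:: p] ->
  q.1 <= c /\ exists k, q = iter k (bracket x) p.
Proof.
move=> pc; elim: e q => [|e IH] q /=.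
  by rewrite inE => /eqP->; split=> //; exists 0.
move=> /flattenP[_ /mapP[r /IH[rc [k rE]] ->]].
rewrite inE => /orP[/eqP->|]; first by split=> //; exists k.
case: ifP => // le_c; rewrite inE => /eqP ->; split=> //.
by exists k.+1; rewrite rE.
Qed.

Lemma mem_collect x w q : {in w, forall p, p.1 <= c} -> q \in (collect x w).2 ->
  q.1 <= c /\ exists k, exists2 p, (p \in w) && (p != x) & q = iter k (bracket x) p.
Proof.
elim: w => [|p w IH] //= wc.
have {}IH := IH (fun q qw => wc q (mem_behead (s := p :: w) qw)).
case: (collect x w) IH => e u /= IH; have [->|p_x] := eqVneq p x => /=.
  move=> /IH[qc [k [r /andP[rw rx] qE]]]; split=> //.
  by exists k, r => //; rewrite inE rw orbT.
have pc := wc p (mem_head _ _).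
rewrite mem_cat => /orP[/(mem_iter_conjw pc)[qc [k qE]]|/IH[qc [k [r /andP[rw rx] qE]]]].
  by split=> //; exists k, p => //; rewrite mem_head p_x.
by split=> //; exists k, r => //; rewrite inE rw orbT.
Qed.

Definition words A C n : set G :=
  [set g | exists w, [/\ {subset w <= A}, mass n w <= C * n ^ c & word_val w = g]].

Definition alphabet A : Prop := {in A, forall p, p.1 <= c /\ in_filtration p}.

Lemma iter_bracket1 x k p : (iter k (bracket x) p).1 = p.1 + k * x.1.
Proof. by elim: k => [|k /= ->]; rewrite ?addn0 // mulSn; lia. Qed.

(** [A'] depends on neither [n] nor [C]. The brackets it adds are heavier than [x], so collecting
    never creates letters of the weight of [x], and the letters of one weight can be removed one
    after another. *)
Lemma collect_words A x : alphabet A -> x.1 <= c -> in_filtration x ->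
  exists A', [/\ alphabet A',
    {in A', forall p, p \in A /\ p != x \/ exists2 q, q \in A & q.1 + x.1 <= p.1} &
    forall C n g, 0 < n -> words A C n g -> exists e, exists2 h,
      e <= C * n ^ x.1 /\ words A' (4 ^ C * C) n h & g = (x.2 ^+ e * h)%g].
Proof.
move=> alA xc fx.
(* Since [x] has positive weight, more than [c] brackets with it would give a weight above [c];
   hence [k] ranges up to [c]. *)
exists [seq p <- [seq iter k (bracket x) q | q <- [seq q <- A | q != x], k <- iota 0 c.+1] |
  p.1 <= c].
split=> [p|p|C n g n0 [w [wA wm <-]]].
- rewrite mem_filter => /andP[pc /allpairsP[[q k] /= [qA _ pE]]].
  move: qA; rewrite mem_filter => /andP[_ /alA[_ fq]].
  split=> //; rewrite pE {pc pE p}.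
  by elim: k => [|k IH] //=; apply: in_filtration_bracket.
- rewrite mem_filter => /andP[pc /allpairsP[[q k] /= [qA _ pE]]].
  move: qA; rewrite mem_filter => /andP[qx qA]; rewrite pE.
  case: k pE => [|k] pE; first by left.
  by right; exists q => //; rewrite iter_bracket1 mulSn; lia.
have n0' : 0 < n ^ (c - x.1) by rewrite expn_gt0 n0.
have count_le : (collect x w).1 <= C * n ^ x.1.
  rewrite -(leq_pmul2r n0') -mulnA -expnD subnKC //.
  exact: leq_trans (collect_count _ _ _) wm.
have fw : {in w, forall p, in_filtration p} by move=> p /wA/alA[].
exists (collect x w).1, (word_val (collect x w).2); last exact: word_val_collect.
split=> //; exists (collect x w).2; split=> //.
  move=> q /mem_collect[p /wA/alA[]//|qc [k [p /andP[pw px] qE]]].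
  rewrite mem_filter qc; apply/allpairsP; exists (p, k); split=> //.
    by rewrite mem_filter px wA.
  have [x0 _] := fx; move: qc; rewrite qE iter_bracket1 mem_iota [(p, k).2]/=; nia.
by apply: leq_trans (mass_collect n0 count_le) _; rewrite -mulnA leq_mul2l wm orbT.
Qed.

Lemma words_mul A B C D n g h :
  words A C n g -> words B D n h -> words (A ++ B) (C + D) n (g * h)%g.
Proof.
move=> [w [wA wm <-]] [u [uB um <-]]; exists (w ++ u); split.
- by move=> p; rewrite !mem_cat => /orP[/wA->|/uB->]; rewrite ?orbT.
- by rewrite mass_cat mulnDl leq_add.
- exact: word_val_cat.
Qed.

Lemma mass_le_size n j u : 0 < n -> {in u, forall p, j <= p.1} ->
  mass n u <= size u * n ^ (c - j).
Proof.
move=> n0; elim: u => [|p u IH] uj; first by rewrite /mass big_nil.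
rewrite mass_cons mulSn leq_add ?IH // => [|q qu]; last by apply: uj; rewrite inE qu orbT.
by rewrite leq_pexp2l // leq_sub2l // uj // mem_head.
Qed.

(** Each copy of [u] has mass at most [size u * n ^ (c - j)], so [C * n ^ j] copies stay within
    order [n ^ c]: an element of weight [j] may be raised to powers of order [n ^ j]. *)
Lemma words_exp j u C n e : 0 < n -> j <= c -> {in u, forall p, j <= p.1} -> e <= C * n ^ j ->
  words u (size u * C) n (word_val u ^+ e)%g.
Proof.
move=> n0 jc uj le_e; exists (flatten (nseq e u)); split.
- by move=> p /flattenP[s /nseqP[->]].
- apply: leq_trans (_ : e * (size u * n ^ (c - j)) <= _).
    elim: (e) => [|i IH]; first by rewrite /mass big_nil.
    by rewrite /= mass_cat mulSn leq_add // mass_le_size.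
  apply: leq_trans (leq_mul le_e (leqnn _)) _.
  by rewrite mulnACA [C * _]mulnC -expnD subnKC.
- elim: (e) => [|i IH]; first by rewrite /word_val big_nil.
  by rewrite /= word_val_cat IH expgS.
Qed.

(** Every [C] is allowed because each collection replaces it by a larger constant, such as
    [4 ^ C * C], that is independent of [n]. *)
Definition growth_le A k : Prop := forall C, exists K, forall n, 0 < n ->
  exists2 s : seq G, size s <= K * n ^ k & forall g, words A C n g -> g \in s.

Lemma growth_le_nil : growth_le [::] 0.
Proof.
move=> C; exists 1 => n n0; exists [:: 1%g] => // g [w [w0 _ <-]].
case: w w0 => [|p w] w0; first by rewrite /word_val big_nil mem_head.
by have := w0 p (mem_head _ _).
Qed.

(** Splitting off a left factor with $O(n^d)$ possible values multiplies the bounds. The alphabet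
    [A'] for the right factor may depend on [C], but not on [n]. *)
Lemma growth_le_cover A d k :
  (forall C, exists A' C' K, growth_le A' k /\ forall n, 0 < n ->
    exists2 s : seq G, size s <= K * n ^ d &
      forall g, words A C n g -> exists y h, [/\ y \in s, words A' C' n h & g = (y * h)%g]) ->
  growth_le A (d + k).
Proof.
move=> cover C; have [A' [C' [K [grA' {}cover]]]] := cover C.
have [K' {}grA'] := grA' C'; exists (K * K') => n n0.
have [s sK sP] := cover n n0; have [s' sK' sP'] := grA' n n0.
exists [seq (y * h)%g | y <- s, h <- s'].
  by rewrite size_allpairs expnD mulnACA leq_mul.
by move=> g /sP[y [h [ys /sP' hs ->]]]; apply/allpairsP; exists (y, h).
Qed.

(** Words carry no negative exponents, so the inverses of the generators are separate letters. *)
Definition pm_letters j (l : seq G) : seq letter :=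
  [seq (j, a) | a <- l] ++ [seq (j, a^-1)%g | a <- l].

Lemma word_of_generated j (l : seq G) g : 0 < j <= c -> {in l, forall a, Gam j a} ->
  generated ([set` l] `|` Gam j.+1) g -> exists u, [/\ alphabet u,
    {in u, forall p, p \in pm_letters j l \/ j < p.1} & word_val u = g].
Proof.
move=> /andP[j0 jc] lj.
pose M := [set g | exists u, [/\ alphabet u,
    {in u, forall p, p \in pm_letters j l \/ j < p.1} & word_val u = g]].
suff : generated ([set` l] `|` Gam j.+1) `<=` M by apply.
apply: generated_sub => [|y [yl|Gy]].
- split.
  + by exists [::]; split=> //; rewrite /word_val big_nil.
  + move=> x y [u [au lu <-]] [w [aw lw <-]]; exists (u ++ w); split.
    * by move=> p; rewrite mem_cat => /orP[/au|/aw].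
    * by move=> p; rewrite mem_cat => /orP[/lu|/lw].
    * exact: word_val_cat.
  + move=> x [u [au lu <-]]; exists (rev [seq (p.1, p.2^-1)%g | p <- u]); split.
    * move=> p; rewrite mem_rev => /mapP[q /au[qc [q0 Gq]] ->]; split=> //; split=> //.
      exact: subgroupV.
    * move=> p; rewrite mem_rev => /mapP[q /lu[ql|jq] ->]; last by right.
      left; move: ql; rewrite !mem_cat => /orP[] /mapP[a al ->] /=.
        by apply/orP; right; apply: map_f.
      by rewrite invgK; apply/orP; left; apply: map_f.
    * elim: u {au lu} => [|p u IH]; first by rewrite /word_val big_nil invg1.
      by rewrite map_cons rev_cons -cats1 word_val_cat IH !word_val_cons
        /word_val big_nil /= mulg1 invgM.
- exists [:: (j, y)]; split.
  + by move=> p; rewrite inE => /eqP->; split=> //; split=> //; apply: lj.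
  + by move=> p; rewrite inE => /eqP->; left; rewrite mem_cat map_f.
  + by rewrite /word_val big_seq1.
(* An element of [Gam j.+1] is a single letter of weight [j.+1], unless [j = c]: then it is trivial,
   and the empty word represents it. *)
have [jc'|cj] := leqP j.+1 c.
- exists [:: (j.+1, y)]; split.
  + by move=> p; rewrite inE => /eqP->.
  + by move=> p; rewrite inE => /eqP->; right.
  + by rewrite /word_val big_seq1.
- exists [::]; split=> //.
  by rewrite /word_val big_nil (Gam_triv cj Gy).
Qed.

(** * Counting the contribution of one weight *)

Section Layer.
Variables (j d : nat).
Hypotheses (j_gt0 : 0 < j) (j_le_c : j <= c).
Hypothesis IHd : forall A, alphabet A -> {in A, forall p, j < p.1} -> growth_le A d.

Lemma pm_letters_weight (l : seq G) p : p \in pm_letters j l -> p.1 = j.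
Proof. by rewrite mem_cat => /orP[]/mapP[a _ ->]. Qed.

(** Collecting [a] and then its inverse leaves a power of [a] whose exponent is $O(n^j)$ in absolute
    value, which costs a factor of order [n ^ j] per generator. When the list is exhausted only
    heavier letters remain, and [IHd] applies. *)
Lemma growth_le_generators (l : seq G) A : alphabet A -> {in l, forall a, Gam j a} ->
  {in A, forall p, p \in pm_letters j l \/ j < p.1} -> growth_le A (j * size l + d).
Proof.
elim: l A => [|a l IH] A alA lj Al /=.
  by rewrite muln0; apply: IHd => // p /Al[].
rewrite mulnS -addnA; apply: growth_le_cover => C.
have fa : in_filtration (j, a) by split=> //; apply: lj; rewrite mem_head.
have fb : in_filtration (j, a^-1%g) by split=> //; apply: (subgroupV (GamP j)); case: fa.
have [A1 [alA1 A1P coll1]] := @collect_words A (j, a) alA j_le_c fa.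
have [A2 [alA2 A2P coll2]] := @collect_words A1 (j, a^-1%g) alA1 j_le_c fb.
have A1j p : p \in A1 -> j <= p.1.
  move=> /A1P[[/Al[/pm_letters_weight->//|/ltnW//]]|[q _ /=]]; lia.
(* Two successive collections turn [C] into [4 ^ C * C] and then apply the same map to this value.
   The last constant counts the exponents of both signs, zero included. *)
exists A2, (4 ^ (4 ^ C * C) * (4 ^ C * C)), ((4 ^ C * C).+1 * 2); split.
  apply: IH => //; first by move=> b bl; apply: lj; rewrite inE bl orbT.
  move=> p /A2P[[/A1P[[/Al[pl|jp] pa]|[q /Al qj /= qp]] pb]|[q /A1j jq /= qp]].
  - by left; move: pl; rewrite !mem_cat /= !inE (negPf pa) (negPf pb).
  - by right.
  - by right; case: qj => [/pm_letters_weight qj|]; lia.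
  - by right; lia.
move=> n n0; set E := 4 ^ C * C * n ^ j.
exists ([seq (a ^+ i)%g | i <- iota 0 E.+1] ++ [seq (a ^- i)%g | i <- iota 0 E.+1]).
  rewrite size_cat !size_map size_iota.
  have : 0 < n ^ j by rewrite expn_gt0 n0.
  by rewrite /E; nia.
move=> g /(coll1 _ _ _ n0)[e [h [le_e /(coll2 _ _ _ n0)[e' [h' [le_e' wh'] ->]]] ->]].
exists (a ^+ e * a ^- e')%g, h'; split=> //;
  last by rewrite [(_, _).2]/= [(_, _).2]/= expVgn mulgA.
rewrite mem_cat; have [le|lt] := leqP e' e.
  rewrite -expgnFr // map_f // mem_iota add0n ltnS leq0n andTb /E.
  apply: leq_trans (leq_subr _ _) _; apply: leq_trans le_e _; rewrite leq_mul2r.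
  by apply/orP; right; rewrite leq_pmull // expn_gt0.
apply/orP; right.
have -> : (a ^+ e * a ^- e')%g = (a ^- (e' - e))%g.
  by rewrite expgnFr ?(ltnW lt) // invgM invgK.
by apply: (map_f (fun i => a ^- i)%g);
  rewrite mem_iota add0n ltnS leq0n andTb (leq_trans (leq_subr _ _)).
Qed.

Lemma growth_le_layer (l : seq G) A : alphabet A -> {in l, forall a, Gam j a} ->
  (forall t, Gam j t -> exists2 q, 0 < q &
     generated ([set` l] `|` Gam j.+1) (t ^+ q)%g) ->
  {in A, forall p, j <= p.1} -> growth_le A (j * size l + d).
Proof.
move=> alA lj lgen Aj.
pose M : seq letter := [seq p <- A | p.1 == j].
have : {in A, forall p, p \in M \/ (p \in pm_letters j l \/ j < p.1)}.
  move=> p pA; rewrite mem_filter pA andbT; have := Aj p pA.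
  by rewrite leq_eqVlt eq_sym => /orP[]; auto.
have : {in M, forall p, in_filtration p /\ p.1 = j}.
  by move=> p; rewrite mem_filter => /andP[/eqP-> /alA[]].
(* Collect the letters [t] of [M] one at a time. In
   [t ^+ e = t ^+ (e %% q) * (t ^+ q) ^+ (e %/ q)], the first factor takes [q]
   values, and the second is a word in the generators and in higher weights. *)
move: M => /= M; elim: M A alA {Aj} => [|t M IH] A alA MP AM.
  by apply: growth_le_generators => // p /AM[].
(* The [q] residues of the exponent of [t] are bounded in number independently of [n], so they
   contribute degree 0. *)
rewrite -[_ + d]add0n; apply: growth_le_cover => C.
have [ft tj] := MP t (mem_head _ _).
have tc : t.1 <= c by rewrite tj.
have [A' [alA' A'P coll]] := @collect_words A t alA tc ft.
have Gt : Gam j t.2 by rewrite -tj; case: ft.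
have [|q q0 /word_of_generated[||u [alu uP uE]]] := lgen t.2; rewrite ?j_gt0 //.
have uj : {in u, forall p, j <= p.1}.
  by move=> p /uP[/pm_letters_weight->//|/ltnW].
have ftj p : p \in M -> in_filtration p /\ p.1 = j by move=> pM; apply: MP; rewrite inE pM orbT.
exists (u ++ A'), (size u * C + 4 ^ C * C), q; split.
  apply: IH.
  - by move=> p; rewrite mem_cat => /orP[/alu|/alA'].
  - by move=> p /ftj.
  - move=> p; rewrite mem_cat => /orP[/uP|]; first by right.
    case/A'P => [[/AM[|]]|[r /AM rP]].
    + by rewrite inE => /orP[/eqP->|]; [rewrite eqxx|left].
    + by right.
    + move=> rp; right; right; case: rP => [/MP[_ rj]|[/pm_letters_weight rj|rj]]; lia.
move=> n n0; exists [seq (t.2 ^+ i)%g | i <- iota 0 q].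
  by rewrite size_map size_iota muln1.
move=> g /(coll _ _ _ n0)[e [h [le_e wh] ->]]; rewrite tj in le_e.
exists (t.2 ^+ (e %% q))%g, (word_val u ^+ (e %/ q) * h)%g; split.
- by rewrite map_f // mem_iota add0n ltn_mod.
- apply: words_mul => //; apply: (words_exp n0 j_le_c uj).
  exact: leq_trans (leq_div _ _) le_e.
- by rewrite uE {1}(divn_eq e q) addnC expgnDr mulnC expgnA mulgA.
Qed.

End Layer.

Variable gens : nat -> seq G.
Hypothesis gens_sub : forall j, 0 < j <= c -> {in gens j, forall a, Gam j a}.
Hypothesis gensP : forall j t, 0 < j <= c -> Gam j t ->
  exists2 q, 0 < q & generated ([set` gens j] `|` Gam j.+1) (t ^+ q)%g.

(** Descending induction on the lowest weight [j], with [m] counting the layers left. For [j = c.+1]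
    the alphabet is empty, since its letters have weight at most [c]. *)
Lemma growth_le_alphabet A : alphabet A ->
  growth_le A (\sum_(1 <= i < c.+1) i * size (gens i)).
Proof.
suff H m j A' : m = c.+1 - j -> 0 < j <= c.+1 -> alphabet A' -> {in A', forall p, j <= p.1} ->
    growth_le A' (\sum_(j <= i < c.+1) i * size (gens i)).
  by move=> alA; apply: H => // p /alA[_ []].
elim: m j A' => [|m IH] j A' mE /andP[j0 jc] alA jA.
  have -> : A' = [::].
    by case: A' alA jA => // p A' /(_ p (mem_head _ _))[pc _] /(_ p (mem_head _ _)); lia.
  by rewrite big_geq; [apply: growth_le_nil|lia].
rewrite big_ltn; last by lia.
have j0c : 0 < j <= c by lia.
apply: growth_le_layer => //.
- by lia.
- by move=> B alB Bj; apply: IH => //; lia.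
- exact: gens_sub.
- by move=> t; apply: gensP.
Qed.

End Collection.

(** * Ranks *)

Local Open Scope ring_scope.

(** A spanning family of minimal length is a basis: two different coordinate vectors of one element
    would express some [e i0] through the others, which would then already span. *)
Lemma has_dim_of_span (V : lmodType rat) (r : nat) (e : 'I_r -> V) :
  (forall v, exists c : {ffun 'I_r -> rat}, v = \sum_i c i *: e i) ->
  exists r', has_dim V r'.
Proof.
pose spanned r := exists e : 'I_r -> V,
  forall v, exists c : {ffun 'I_r -> rat}, v = \sum_i c i *: e i.
move=> eP; have : exists r', `[< spanned r' >] by exists r; apply/asboolP; exists e.
case/ex_minnP => {e eP}r /asboolP[e eP] rmin; exists r, e => v.
have [c cE] := eP v; exists c; split=> // c' c'E; apply/ffunP => i0.
apply/eqP/negPn/negP => c_neq.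
have dc : c i0 - c' i0 != 0 by rewrite subr_eq0.
have s0 : \sum_i (c i - c' i) *: e i = 0.
  by under eq_bigr do rewrite scalerBl; rewrite sumrB -cE -c'E subrr.
case: r e eP rmin c c' i0 cE c'E c_neq dc s0 => [|r] e eP rmin c c' i0 cE c'E _ dc s0.
  by case: i0 dc => [[]].
suff : `[< spanned r >] by move=> /rmin; rewrite ltnn.
apply/asboolP; exists (fun i => e (lift i0 i)) => u.
have [b ->] := eP u.
exists [ffun i => b (lift i0 i) - b i0 / (c i0 - c' i0) * (c (lift i0 i) - c' (lift i0 i))].
have ei0 : e i0 = - \sum_i ((c (lift i0 i) - c' (lift i0 i)) / (c i0 - c' i0)) *: e (lift i0 i).
  move: s0; rewrite (bigD1_ord i0) //= => /eqP; rewrite addr_eq0 => /eqP s0.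
  apply: (scalerI dc); rewrite s0 scalerN scaler_sumr; congr (- _).
  by apply: eq_bigr => i _; rewrite scalerA mulrCA divff // mulr1.
rewrite (bigD1_ord i0) //= ei0 scalerN addrC -scaleN1r !scaler_sumr -big_split /=.
apply: eq_bigr => i _; rewrite ffunE !scalerA -scalerDl; congr (_ *: _).
by rewrite mulN1r mulNr mulrA [in RHS]mulrAC.
Qed.

Lemma common_denominator (I : finType) (c : I -> rat) :
  exists2 D : nat, (0 < D)%N & exists z : I -> int, forall i, D%:R * c i = (z i)%:~R.
Proof.
exists (\prod_i `|denq (c i)|)%N; first by rewrite prodn_gt0 // => i;
  rewrite absz_gt0 denq_neq0.
exists (fun i => numq (c i) * (\prod_(k | k != i) `|denq (c k)|)%N) => i.
rewrite (bigD1 i) //= natrM mulrAC intrM; congr (_ * _).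
by rewrite mulrC [RHS]numqE -[denq _ in RHS]gez0_abs ?denq_ge0.
Qed.

Section TensorRank.
Variable A : zmodType.
Implicit Types (a b : A) (s t : formal_sum A).

Definition tensorQ_inj a : tensorQ A := tensorQ_mk [:: (1, a)].

Lemma tensorQ_mk_cat s t : tensorQ_mk (s ++ t) = tensorQ_mk s + tensorQ_mk t.
Proof. exact: esym (tensorQ_addE s t). Qed.

Lemma tensorQ_injD a b : tensorQ_inj (a + b) = tensorQ_inj a + tensorQ_inj b.
Proof. by rewrite -tensorQ_mk_cat; apply/tensorQ_mkP; apply: TQDr. Qed.

Lemma tensorQ_inj_is_zmod_morphism : zmod_morphism tensorQ_inj.
Proof.
by move=> a b; apply: (addIr (tensorQ_inj b)); rewrite -tensorQ_injD !subrK.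
Qed.

HB.instance Definition _ :=
  GRing.isZmodMorphism.Build A (tensorQ A) tensorQ_inj tensorQ_inj_is_zmod_morphism.

Lemma tensorQ_mk1 (q : rat) a : tensorQ_mk [:: (q, a)] = q *: tensorQ_inj a.
Proof. by rewrite [RHS](tensorQ_scaleE q) /= mulr1. Qed.

Lemma tensorQ_clear_denominator (v : tensorQ A) :
  exists2 m : nat, (0 < m)%N & exists a, m%:R *: v = tensorQ_inj a.
Proof.
rewrite -(tensorQ_mkK v); elim: (repr v) => [|[q a] s [m m0 [b IH]]].
  by exists 1%N => //; exists 0; rewrite !raddf0.
exists (m * `|denq q|)%N; first by rewrite muln_gt0 m0 absz_gt0 denq_neq0.
exists (a *~ (numq q * m) + b *+ `|denq q|).
rewrite (tensorQ_mk_cat [:: (q, a)] s) scalerDr raddfD raddfMz raddfMn /= -IH; congr (_ + _).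
  rewrite tensorQ_mk1 scalerA -scaler_int; congr (_ *: _).
  rewrite intrM natrM [RHS]mulrC -mulrA; congr (_ * _).
  by rewrite mulrC [RHS]numqE -[denq _ in RHS]gez0_abs ?denq_ge0.
by rewrite mulnC natrM -scalerA scaler_nat.
Qed.

(* Evaluation of [D *: s] in [A], meaningful when [D] is a multiple of all the
   denominators of [s]; the relations of the tensor product preserve it for all
   sufficiently divisible [D]. *)
Definition eval_multiple (D : nat) s : A := \sum_(u <- s) u.2 *~ numq (D%:R * u.1).

Lemma numq_nat_mul_dvd (D : nat) (q : rat) : (`|denq q| %| D)%N ->
  exists z : int, D%:R * q = z%:~R.
Proof.
move=> /dvdnP[k ->]; exists (k%:Z * numq q); rewrite natrM -mulrA intrM; congr (_ * _).
by rewrite mulrC [RHS]numqE -[denq _ in RHS]gez0_abs ?denq_ge0.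
Qed.

Lemma eval_multiple_rel s t : tensorQ_rel s t ->
  exists2 D : nat, (0 < D)%N & forall D', (D %| D')%N -> eval_multiple D' s =
    eval_multiple D' t.
Proof.
elim=> {s t} [s|s t _ [D D0 IH]|s t u _ [D D0 IH] _ [E E0 IH']
  |s s' t t' _ [D D0 IH] _ [E E0 IH']|s t|a|p q a|q a b].
- by exists 1%N.
- by exists D => // D' /IH.
- exists (D * E)%N; first by rewrite muln_gt0 D0.
  by move=> D' DD; rewrite IH ?IH' //; apply: dvdn_trans DD;
    [apply: dvdn_mull|apply: dvdn_mulr].
- exists (D * E)%N; first by rewrite muln_gt0 D0.
  move=> D' DD;
    rewrite /eval_multiple !big_cat /= -/(eval_multiple D' s) -/(eval_multiple D' t).
  by rewrite IH ?IH' //; apply: dvdn_trans DD; [apply: dvdn_mull|apply: dvdn_mulr].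
- by exists 1%N => // D' _; rewrite /eval_multiple !big_cat /= addrC.
- by exists 1%N => // D' _; rewrite /eval_multiple big_seq1 big_nil /= mulr0 mulr0z.
(* The function [numq] is additive on integers but not on rationals, so [D] has to clear both
   denominators. *)
- exists (`|denq p| * `|denq q|)%N; first by rewrite muln_gt0 !absz_gt0 !denq_neq0.
  move=> D' DD; rewrite /eval_multiple big_seq1 big_cons big_seq1 /= mulrDr -mulrzDr.
  have [z ->] := @numq_nat_mul_dvd D' p (dvdn_trans (dvdn_mulr _ (dvdnn _)) DD).
  have [z' ->] := @numq_nat_mul_dvd D' q (dvdn_trans (dvdn_mull _ (dvdnn _)) DD).
  by rewrite -intrD !numq_int.
- by exists 1%N => // D' _; rewrite /eval_multiple big_seq1 big_cons big_seq1 /= mulrzDl.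
Qed.

(** The kernel of $A \to \mathbb{Q} \otimes A$ is torsion: for a suitable [D], [eval_multiple D]
    sends the symbol of [a] to [a *+ D] and the empty sum to 0. *)
Lemma tensorQ_inj_eq0 a : tensorQ_inj a = 0 -> exists2 m : nat, (0 < m)%N & a *+ m = 0.
Proof.
move=> /tensorQ_mkP/eval_multiple_rel[D D0 /(_ D (dvdnn D))].
rewrite /eval_multiple big_seq1 big_nil /= mulr1 => aD; exists D => //.
by rewrite -[RHS]aD pmulrn (numq_int D).
Qed.

Definition zmod_subgroup (P : set A) : Prop :=
  [/\ P 0, (forall a b, P a -> P b -> P (a + b)) & (forall a, P a -> P (- a))].

Lemma zmod_subgroupMz P a (z : int) : zmod_subgroup P -> P a -> P (a *~ z).
Proof.
move=> [P0 PD PN] Pa.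
have Pn n : P (a *+ n) by elim: n => [|n IH]; rewrite ?mulr0n // mulrS; apply: PD.
by case: z => n; [apply: Pn|rewrite NegzE mulrNz; apply: PN; apply: Pn].
Qed.

(** Clearing denominators in a basis of $\mathbb{Q} \otimes A$ gives elements that generate a
    subgroup with torsion quotient. Generated subgroups are expressed by quantifying over all
    subgroups [P] that contain the generators. *)
Lemma zrank_generators (F : seq A) :
  (forall P : set A, zmod_subgroup P -> {in F, forall a, P a} -> forall a, P a) ->
  exists2 l : seq A, size l = zrank A & forall a, exists2 q : nat, (0 < q)%N &
    forall P : set A, zmod_subgroup P -> {in l, forall b, P b} -> P (a *+ q).
Proof.
move=> Fgen; have [|r Vr] := @has_dim_of_span (tensorQ A) (size F) (fun i => tensorQ_inj F`_i).
  move=> v; pose P := [set a | exists c : {ffun 'I_(size F) -> rat}, tensorQ_inj a =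
    \sum_i c i *: tensorQ_inj F`_i].
  have [m m0 [a vE]] := tensorQ_clear_denominator v.
  have [c cE] : P a.
    apply: Fgen => [|b bF].
      split.
      - exists 0; rewrite raddf0 big1 // => i _; by rewrite ffunE scale0r.
      - move=> b b' [c cE] [c' c'E]; exists (c + c'); rewrite raddfD /= cE c'E -big_split /=.
        by apply: eq_bigr => i _; rewrite ffunE scalerDl.
      - move=> b [c cE]; exists (- c); rewrite raddfN /= cE -sumrN.
        by apply: eq_bigr => i _; rewrite ffunE scaleNr.
    have bi : (index b F < size F)%N by rewrite index_mem.
    exists [ffun i => (i == Ordinal bi)%:R]; rewrite (bigD1 (Ordinal bi)) //= big1 ?addr0.
      by rewrite ffunE eqxx scale1r nth_index.
    by move=> i /negPf ni; rewrite ffunE ni scale0r.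
  exists [ffun i => m%:R^-1 * c i].
  have m0' : m%:R != 0 :> rat by rewrite pnatr_eq0 -lt0n.
  apply: (scalerI m0'); rewrite vE cE scaler_sumr; apply: eq_bigr => i _.
  by rewrite ffunE scalerA mulVKf.
(* The finite spanning family rules out the default value 0 that [dimQ] takes in infinite
   dimension. *)
have {r Vr}[e eP] : has_dim (tensorQ A) (zrank A).
  by apply: (@xgetPex _ 0%N [set r | has_dim (tensorQ A) r]); exists r.
have /choice[m /all_and2[m0 /choice[a aE]]] : forall i, exists m : nat,
    (0 < m)%N /\ exists a, m%:R *: e i = tensorQ_inj a.
  by move=> i; have [m m0 [a aE]] := tensorQ_clear_denominator (e i); exists m; split=> //;
    exists a.
exists [seq a i | i <- enum 'I_(zrank A)]; first by rewrite size_map size_enum_ord.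
move=> b; have [c [cE _]] := eP (tensorQ_inj b).
have [D D0 [z zE]] := common_denominator (fun i => c i / (m i)%:R).
(* Multiplying the coordinates of [b] by [D] makes them integral with respect to the [a i]. The
   difference vanishes in the tensor product, so some [q] kills it in [A]. *)
have [|q q0 qE] := @tensorQ_inj_eq0 (b *+ D - \sum_i a i *~ z i).
  rewrite raddfB raddfMn raddf_sum /= cE -scaler_nat scaler_sumr; apply/eqP; rewrite subr_eq0.
  apply/eqP; apply: eq_bigr => i _; rewrite raddfMz /= -aE -scaler_int -zE !scalerA;
    congr (_ *: _).
  by rewrite -mulrA divfK // pnatr_eq0 -lt0n.
exists (D * q)%N; first by rewrite muln_gt0 D0.
move=> P PP lP; have -> : b *+ (D * q) = \sum_i a i *~ (z i * q).
  move: qE; rewrite mulrnBl mulrnA => /eqP; rewrite subr_eq0 => /eqP->.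
  by rewrite -sumrMnl; apply: eq_bigr => i _; rewrite mulrzA pmulrn.
have [P0 PD _] := PP; elim/big_ind: _ => // i _.
by apply: zmod_subgroupMz => //; apply: lP; rewrite map_f ?mem_enum.
Qed.

End TensorRank.

Section AbelianSection.
Variables (G : groupType) (S : abelian_section G).
Let H := abq_num S.
Let K := abq_den S.
Let HP : is_subgroup H := abq_numP S.
Let KP : is_subgroup K := abq_denP S.
Let KH : K `<=` H := @abq_sub G S.

(** The quotient map, made total by the value 0 outside [H] so that it can be mapped over lists
    without membership proofs. *)
Definition abq_class (x : G) : abq S :=
  if pselect (H x) is left Hx then abq_mk Hx else 0.

Lemma abq_classE x (Hx : H x) : abq_class x = abq_mk Hx.
Proof. by rewrite /abq_class; case: pselect => // Hx'; apply: val_inj. Qed.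

Lemma abq_class_surj (C : abq S) : exists2 x, H x & abq_class x = C.
Proof. by have [x [Hx ->]] := abqP C; exists x => //; apply: abq_classE. Qed.

Lemma abq_class_eq x y : H x -> H y -> abq_class x = abq_class y -> K (x^-1 * y)%g.
Proof.
move=> Hx Hy; rewrite (abq_classE Hx) (abq_classE Hy) => /(congr1 val) /= E.
exact/(lcoset_eq S).
Qed.

Lemma abq_classM x y : H x -> H y -> abq_class (x * y)%g = abq_class x + abq_class y.
Proof.
move=> Hx Hy; rewrite (abq_classE (subgroupM HP Hx Hy)) (abq_classE Hx) (abq_classE Hy).
by apply: val_inj; rewrite /= setmul_lcoset.
Qed.

Lemma abq_class_den x : K x -> abq_class x = 0.
Proof.
move=> Kx; rewrite (abq_classE (KH Kx)); apply: val_inj; apply/(lcoset_eq S).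
by rewrite mulg1; apply: subgroupV.
Qed.

Lemma abq_classV x : H x -> abq_class x^-1%g = - abq_class x.
Proof.
move=> Hx; apply: (addIr (abq_class x)); rewrite addNr -abq_classM //; last exact: subgroupV.
by rewrite mulVg abq_class_den //; apply: subgroup1.
Qed.

Lemma abq_classX x n : H x -> abq_class (x ^+ n)%g = abq_class x *+ n.
Proof.
move=> Hx; elim: n => [|n IH]; first by rewrite expg0 abq_class_den //; apply: subgroup1.
by rewrite expgS mulrS abq_classM ?IH //; apply: subgroupX.
Qed.

Lemma zrank_abq_generators (F : seq G) : {in F, forall x, H x} ->
  H = generated ([set` F] `|` K) ->
  exists l : seq G, [/\ size l = zrank (abq S), {in l, forall x, H x} &
    forall t, H t -> exists2 q : nat, (0 < q)%N &
      generated ([set` l] `|` K) (t ^+ q)%g].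
Proof.
move=> FH HE.
have [P PP PF|l lsize lP] := @zrank_generators (abq S) [seq abq_class f | f <- F].
  move=> C; have [x Hx <-] := abq_class_surj C.
  pose M := [set x | H x /\ P (abq_class x)].
  have [P0 PD PN] := PP.
  suff : H `<=` M by move=> /(_ _ Hx)[].
  rewrite [X in X `<=` _]HE; apply: generated_sub => [|y [yF|Ky]].
  - split=> [|a b [Ha Pa] [Hb Pb]|a [Ha Pa]].
    + by split; [apply: subgroup1|rewrite abq_class_den //; apply: subgroup1].
    + by split; [apply: subgroupM|rewrite abq_classM //; apply: PD].
    + by split; [apply: subgroupV|rewrite abq_classV //; apply: PN].
  - by split; [apply: FH|apply: PF; apply: map_f].
  - by split; [apply: KH|rewrite abq_class_den].
have /choice[rep /all_and2[repH repE]] : forall C : abq S, exists x, H x /\ abq_class x = C.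
  by move=> C; have [x] := abq_class_surj C; exists x.
exists [seq rep C | C <- l]; split; first by rewrite size_map.
  by move=> _ /mapP[C _ ->]; apply: repH.
move=> t Ht; have [q q0 qP] := lP (abq_class t); exists q => //.
set J := generated _; have JP : is_subgroup J by exact: generated_subgroup.
(* The classes of the elements of [J] in [H] form a subgroup containing [l]. So [t ^+ q] agrees
   modulo [K] with some [h] in [J], and [K] itself lies in [J]. *)
have [|C Cl|h [Jh Hh]] := qP [set C | exists h, [/\ J h, H h & abq_class h = C]].
- split.
  + by exists 1%g; split;
      [apply: (subgroup1 JP)|apply: subgroup1|rewrite abq_class_den //; apply: subgroup1].
  + move=> C D [x [Jx Hx <-]] [y [Jy Hy <-]]; exists (x * y)%g.
    by split; [apply: (subgroupM JP)|apply: subgroupM|rewrite abq_classM].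
  + move=> C [x [Jx Hx <-]]; exists x^-1%g.
    by split; [apply: (subgroupV JP)|apply: subgroupV|rewrite abq_classV].
- exists (rep C); split=> //.
  by apply: mem_generated; left; rewrite /= map_f.
rewrite -abq_classX // => /abq_class_eq-/(_ Hh (subgroupX HP _ Ht)) Kht.
rewrite -(mulVKg h (t ^+ q)%g); apply: (subgroupM JP) => //.
by apply: mem_generated; right.
Qed.

End AbelianSection.

Lemma lcs_generators (G : groupType) (N : set G) (NP : is_subgroup N) (s : seq G) (n : nat) :
  generated [set` s] = N ->
  exists l : seq G, [/\ size l = Rk NP n.+1, {in l, forall x, lcs N n x} &
    forall t, lcs N n t -> exists2 q : nat, (0 < q)%N &
      generated ([set` l] `|` lcs N n.+1) (t ^+ q)%g].
Proof.
move=> sN; have [F FL FE] := lcs_fg_mod NP n sN.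
exact: (@zrank_abq_generators G (lcs_section NP n) F).
Qed.

Lemma has_dim_trivial (V : lmodType rat) r : (forall v : V, v = 0) -> has_dim V r -> r = 0%N.
Proof.
move=> V0 [e /(_ 0)[c [_ cU]]]; apply/eqP; rewrite -leqn0 leqNgt; apply/negP => r0.
(* In a trivial space every coefficient vector represents 0, so uniqueness identifies [c] with
   [c + 1], which is absurd at an existing index. *)
have := cU (c + 1) (esym (V0 _)); rewrite -[LHS]addr0 => /addrI/ffunP/(_ (Ordinal r0)).
by rewrite !ffunE => /eqP; rewrite eq_sym oner_eq0.
Qed.

Lemma Rk_trivial (G : groupType) (N : set G) (NP : is_subgroup N) n :
  lcs N n = [set 1%g] -> Rk NP n.+1 = 0%N.
Proof.
move=> Ln; rewrite /Rk /zrank /dimQ /=; case: xgetP => // r _ /=; apply: has_dim_trivial => v.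
have [m m0 [a aE]] := tensorQ_clear_denominator v.
have m0' : m%:R != 0 :> rat by rewrite pnatr_eq0 -lt0n.
apply: (scalerI m0'); rewrite aE scaler0.
have [x] := abq_class_surj a; rewrite /= Ln => -> <-.
rewrite abq_class_den ?raddf0 //.
by apply: subgroup1; apply: lcs_subgroup.
Qed.

Lemma homogeneous_dimE (G : groupType) (N : set G) (NP : is_subgroup N) c :
  lcs N c = [set 1%g] -> homogeneous_dim NP = (\sum_(1 <= i < c.+1) i * Rk NP i)%N.
Proof.
move=> Lc; rewrite /homogeneous_dim (fsbigE (index_iota 1 c.+1)) ?iota_uniq //.
- rewrite big_seq_cond [RHS]big_seq; apply: eq_bigl => i.
  by rewrite mem_index_iota; rewrite andb_idr // => /andP[i0 _]; rewrite inE.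
- by move=> i /=; rewrite mem_index_iota => /andP[].
(* The rank of index [i.+1] concerns [lcs N i], which is already trivial when [c <= i]. *)
case=> // i _; rewrite mem_index_iota /= -leqNgt => ci.
by rewrite Rk_trivial ?muln0 //; apply: (lcs_trivial NP Lc ci).
Qed.

(** * Balls *)

Local Close Scope ring_scope.

Section Balls.
Variable G : groupType.
Implicit Types (S T X : seq G) (x y g : G).

(** Products of exactly [r] elements of [S]; these form the usual ball when [S] contains 1.
    Duplicates are removed so that [size] is the cardinality. *)
Definition ball S r : seq G :=
  iter r (fun B => undup [seq (x * y)%g | x <- S, y <- B]) [:: 1%g].

Lemma ball_uniq S r : uniq (ball S r).
Proof. by case: r => [|r] //=; apply: undup_uniq. Qed.

Lemma mem_ballS S r g :
  g \in ball S r.+1 <-> exists x y, [/\ x \in S, y \in ball S r & g = (x * y)%g].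
Proof.
rewrite /= mem_undup; split=> [/allpairsP[[x y] /= [xS yB ->]]|[x [y [xS yB ->]]]].
  by exists x, y.
by apply/allpairsP; exists (x, y).
Qed.

Lemma ballM S r s x y : x \in ball S r -> y \in ball S s -> (x * y)%g \in ball S (r + s).
Proof.
elim: r x => [|r IH] x; first by rewrite inE => /eqP-> ys; rewrite mul1g.
move=> /mem_ballS[a [b [aS bB ->]]] ys; apply/mem_ballS.
by exists a, (b * y)%g; split=> //; [apply: IH|rewrite mulgA].
Qed.

Lemma mem_ball1 S x : x \in S -> x \in ball S 1.
Proof. by move=> xS; apply/mem_ballS; exists x, 1%g; rewrite mulg1 inE eqxx. Qed.

Lemma ballV S r x : {in S, forall y, (y^-1)%g \in S} -> x \in ball S r -> (x^-1)%g \in ball S r.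
Proof.
move=> SV; elim: r x => [|r IH] x; first by rewrite !inE => /eqP->; rewrite invg1.
move=> /mem_ballS[a [b [aS bB ->]]]; rewrite invgM -addn1; apply: ballM; first exact: IH.
by apply: mem_ball1; apply: SV.
Qed.

Lemma mem_ball_one S r : 1%g \in S -> 1%g \in ball S r.
Proof.
move=> S1; elim: r => [|r IH]; first by rewrite inE.
by apply/mem_ballS; exists 1%g, 1%g; rewrite mulg1.
Qed.

Definition symmetrize S : seq G := 1%g :: S ++ [seq x^-1%g | x <- S].

Lemma symmetrizeV S : {in symmetrize S, forall y, (y^-1)%g \in symmetrize S}.
Proof.
move=> y; rewrite !inE mem_cat => /or3P[/eqP->|yS|/mapP[x xS ->]].
- by rewrite invg1 eqxx.
- by rewrite mem_cat map_f ?orbT.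
- by rewrite invgK mem_cat xS orbT.
Qed.

Lemma ball_generated S g : generated [set` S] g -> exists r, g \in ball (symmetrize S) r.
Proof.
pose M := [set g | exists r, g \in ball (symmetrize S) r].
suff : generated [set` S] `<=` M by apply.
apply: generated_sub => [|x xS].
  split; first by exists 0; rewrite inE.
    by move=> x y [r xr] [s ys]; exists (r + s); apply: ballM.
  by move=> x [r xr]; exists r; apply: ballV => //; apply: symmetrizeV.
by exists 1; apply: mem_ball1; rewrite inE mem_cat xS orbT.
Qed.

Lemma ball_in_generated S r g : g \in ball S r -> generated [set` S] g.
Proof.
have SP := generated_subgroup [set` S].
elim: r g => [|r IH] g; first by rewrite inE => /eqP->; apply: (subgroup1 SP).
move=> /mem_ballS[a [b [aS /IH bB ->]]]; apply: (subgroupM SP) => //.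
exact: mem_generated.
Qed.

(** A product of [n] elements of [T] is a word of [n] letters of weight 1. Its mass is
    [n * n ^ (c - 1) = n ^ c], so the counting bound applies with [C = 1]. *)
Lemma nilpotent_ball_growth (N : set G) (NP : is_subgroup N) (s T : seq G) :
  is_nilpotent N -> generated [set` s] = N -> {in T, forall x, N x} ->
  exists K, forall n, 0 < n -> size (ball T n) <= K * n ^ homogeneous_dim NP.
Proof.
move=> [c0 Lc0] sN TN; pose c := c0.+1.
have Lc : lcs N c = [set 1%g] by apply: (lcs_trivial NP Lc0).
pose Gam i := lcs N i.-1.
have GamP i : is_subgroup (Gam i) by exact: lcs_subgroup.
have Gam_comm i j x y : 0 < i -> 0 < j -> Gam i x -> Gam j y -> Gam (i + j) [~ x, y]%g.
  case: i j => [//|i] [//|j] _ _ Gx Gy; rewrite /Gam addSn addnS /=.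
  exact: (lcs_commg_add NP).
have Gam_triv i x : c < i -> Gam i x -> x = 1%g.
  case: i => // i ci; rewrite /Gam /= (lcs_trivial NP Lc) //.
have /choice[gens /all_and3[gens_size gens_sub gensP]] := fun j => lcs_generators NP j.-1 sN.
pose A : seq (letter G) := [seq (1, t) | t <- T].
have alA : alphabet Gam c A by move=> _ /mapP[t tT ->]; split=> //; split=> //; apply: TN.
have gensP' j t : 0 < j <= c -> Gam j t -> exists2 q, 0 < q &
    generated ([set` gens j] `|` Gam j.+1) (t ^+ q)%g.
  by case: j => [|j] //= _; apply: (gensP j.+1).
have [K HK] := growth_le_alphabet GamP Gam_comm Gam_triv (fun j _ => gens_sub j) gensP' alA 1.
exists K => n n0; have [sq sqK sqP] := HK n n0.
rewrite (homogeneous_dimE NP Lc); apply: leq_trans (_ : size sq <= _).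
  apply: uniq_leq_size (ball_uniq _ _) _ => g gB; apply: sqP.
  suff [w [wA wn wg]] : exists w : seq (letter G), [/\ {subset w <= A}, size w = n & word_val w =
    g].
    exists w; split=> //; apply: leq_trans (mass_le_size c (j := 1) n0 _) _.
      by move=> p /wA/mapP[t _ ->].
    by rewrite wn -expnS mul1n subn1.
  elim: n g gB {n0 sqK} => [|n IH] g.
    by rewrite inE => /eqP->; exists [::]; rewrite /word_val big_nil.
  move=> /mem_ballS[a [b [aT /IH[w [wA wn <-]] ->]]]; exists ((1, a) :: w); split.
  - by move=> p; rewrite inE => /orP[/eqP->|/wA//]; rewrite map_f.
  - by rewrite /= wn.
  - by rewrite word_val_cons.
rewrite (leq_trans sqK) // leq_mul2l leq_pexp2l ?orbT //.
rewrite big_nat [X in _ <= X]big_nat; apply: leq_sum => i /andP[i0 _].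
by rewrite gens_size prednK.
Qed.

(** * Passage to a subgroup of finite index *)

Lemma finite_index_reps (N : set G) : is_subgroup N -> finite_index N ->
  exists (X : seq G) (rho : G -> G), forall g, rho g \in X /\ N ((rho g)^-1 * g)%g.
Proof.
move=> NP /finite_seqP[cs csE].
exists [seq xget 1%g C | C <- cs], (fun g => xget 1%g (lcoset N g)) => g.
have gc : lcoset N g \in cs.
  by have : cosets [set: G] N (lcoset N g) by [exists g]; rewrite csE.
split; first exact: (map_f (xget 1%g)).
have [n Nn E] : lcoset N g (xget 1%g (lcoset N g)).
  by apply: xgetPex; exists g, 1%g; rewrite ?mulg1 //; apply: subgroup1.
by rewrite -E invgM mulgVK; apply: subgroupV.
Qed.

Section Schreier.
Variables (N : set G) (X : seq G) (rho : G -> G).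
Hypothesis NP : is_subgroup N.
Hypothesis rhoP : forall g, rho g \in X /\ N ((rho g)^-1 * g)%g.

Definition schreier S : seq G := [seq ((rho (s * x))^-1 * (s * x))%g | s <- S, x <- X].

Lemma schreier_sub S : {in schreier S, forall x, N x}.
Proof. by move=> _ /allpairsP[[s x] /= [_ _ ->]]; case: (rhoP (s * x)). Qed.

(** The coset representative travels through the word from right to left by
    [s * x = rho (s * x) * t], each letter [s] leaving behind one Schreier generator [t] in [N].
    Hence the length is preserved. *)
Lemma schreier_ball S r g x0 : g \in ball S r -> x0 \in X ->
  exists x t, [/\ x \in X, t \in ball (schreier S) r & (g * x0 = x * t)%g].
Proof.
elim: r g => [|r IH] g.
  by rewrite inE => /eqP-> x0X; exists x0, 1%g; rewrite mulg1 mul1g inE.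
move=> /mem_ballS[a [b [aS bB ->]]] /(IH _ bB)[x [t [xX tB E]]].
exists (rho (a * x)%g), ((rho (a * x))^-1 * (a * x) * t)%g; split.
- by case: (rhoP (a * x)%g).
- by apply/mem_ballS; exists ((rho (a * x))^-1 * (a * x))%g, t; split=> //; apply/allpairsP;
    exists (a, x).
- by rewrite -!mulgA mulVKg E.
Qed.

Lemma size_schreier_ball S r : size (ball S r) <= size X * size (ball (schreier S) r).
Proof.
have [x0X _] := rhoP 1%g.
rewrite -(size_allpairs (fun x t => x * t * (rho 1)^-1)%g).
apply: uniq_leq_size (ball_uniq _ _) _ => g gB.
have [x [t [xX tB E]]] := schreier_ball gB x0X.
by apply/allpairsP; exists (x, t); split=> //=; rewrite -E mulgK.
Qed.

(** For [h] in [N], one has [h * rho 1 = x * t] with [t] a product of Schreier generators. The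
    representative [rho 1] need not be 1, and both [x] and [rho 1] lie in [N]; the elements of [X]
    in [N] are therefore added as generators. *)
Lemma schreier_generated S : generated [set` S] = [set: G] ->
  generated [set` schreier (symmetrize S) ++ [seq x <- X | `[< N x >]]] = N.
Proof.
move=> SG; set T := schreier _; set Y := [set` _].
have YP : is_subgroup (generated Y) by exact: generated_subgroup.
apply/seteqP; split.
  apply: generated_sub => // x; rewrite /Y /= mem_cat mem_filter => /orP[|/andP[/asboolP//]].
  exact: schreier_sub.
move=> h Nh; have [x0X Nx0] := rhoP 1%g.
have {}Nx0 : N (rho 1%g) by rewrite -[rho _]invgK; apply: subgroupV => //;
  rewrite -[(_^-1)%g]mulg1.
have [r hB] : exists r, h \in ball (symmetrize S) r by apply: ball_generated; rewrite SG.
have [x [t [xX tB E]]] := schreier_ball hB x0X.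
have Nt : N t.
  by apply: (generated_sub NP _ (ball_in_generated tB)) => y; apply: schreier_sub.
have Yt : generated Y t.
  by apply: (generated_sub YP _ (ball_in_generated tB)) => y yT; apply: mem_generated;
    rewrite /Y /= mem_cat yT.
have YX y : y \in X -> N y -> generated Y y.
  move=> yX Ny; apply: mem_generated; rewrite /Y /= mem_cat mem_filter yX andbT.
  by apply/orP; right; apply/asboolP.
have Nx : N x.
  have -> : x = (h * rho 1 * t^-1)%g by rewrite E mulgK.
  by apply: subgroupM (subgroupV _ _) => //; apply: subgroupM.
have -> : h = (x * t * (rho 1)^-1)%g by rewrite -E mulgK.
apply: (subgroupM YP); last by apply: (subgroupV YP); apply: YX.
by apply: (subgroupM YP) => //; apply: YX.
Qed.

End Schreier.

Lemma ball_growth S k : finitely_generated G -> growth_degree G k ->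
  exists K, forall n, 0 < n -> size (ball S n) <= K * n ^ k.
Proof.
move=> [_ /finite_seqP[s ->] sG] [N [NP [Nnil Nfin ->]]].
have [X [rho rhoP]] := finite_index_reps NP Nfin.
(* The Schreier construction serves twice: on [s] to show that [N] is finitely generated, and on the
   arbitrary list [S] to compare balls. *)
have sN := schreier_generated NP rhoP sG.
have [K HK] := nilpotent_ball_growth NP Nnil sN (schreier_sub rhoP (S := S)).
exists (size X * K) => n n0; apply: leq_trans (size_schreier_ball rhoP S n) _.
by rewrite -mulnA leq_mul2l HK ?orbT.
Qed.

End Balls.

(* Otherwise [f] would grow at least like [(3 ^ k + 1 / m) ^ i] along the
   sequence [r = 1, 4, 13, ...] of size about [3 ^ i]. *)
Lemma polynomial_growth_ratio (f : nat -> nat) k K m :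
  (forall r, 0 < f r) -> (forall r, 0 < r -> f r <= K * r ^ k) -> 0 < m ->
  exists2 r, 0 < r & m * f (3 * r + 1) < (3 ^ k * m + 1) * f r.
Proof.
move=> f0 fK m0; apply: contrapT => H.
have {}H r : 0 < r -> (3 ^ k * m + 1) * f r <= m * f (3 * r + 1).
  by move=> r0; rewrite leqNgt; apply/negP => lt; apply: H; exists r.
pose rr i := iter i (fun r => 3 * r + 1) 1.
have rr0 i : 0 < rr i by case: i => [//|i]; rewrite /rr /= addn1.
have rr3 i : 2 * rr i + 1 <= 3 ^ i.+1.
  by elim: i => [//|i]; rewrite /rr /= -/(rr i) [3 ^ i.+2]expnS; lia.
set Q := 3 ^ k * m.
have Q0 : 0 < Q by rewrite muln_gt0 expn_gt0.
have lower i : (Q + 1) ^ i <= m ^ i * f (rr i).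
  elim: i => [|i IH]; first by rewrite mul1n.
  rewrite [(Q + 1) ^ _]expnS; apply: leq_trans (leq_mul (leqnn _) IH) _.
  rewrite mulnCA [m ^ i.+1]expnSr -mulnA leq_mul2l; apply/orP; right.
  exact: H.
have upper i : (Q + 1) ^ i <= (K * 3 ^ k) * Q ^ i.
  apply: leq_trans (lower i) _; apply: leq_trans (leq_mul (leqnn _) (fK _ (rr0 i))) _.
  have -> : K * 3 ^ k * Q ^ i = m ^ i * (K * (3 ^ i.+1) ^ k).
    by rewrite /Q expnMn -!expnM mulSnr expnD [i * k]mulnC; nia.
  rewrite !leq_mul2l leq_exp_base ?orbT //; have := rr3 i; lia.
have lin i : Q ^ i * (Q + i) <= Q * (Q + 1) ^ i.
  elim: i => [|i IH]; first by rewrite addn0 mulnC.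
  rewrite !expnS; nia.
(* Together [lin], which is Bernoulli's inequality for $(1 + 1/Q)^i$, and [upper] give $Q + i \leq K
   3^k Q$, which this choice of [i] violates. *)
have := upper (K * 3 ^ k * Q).+1; have := lin (K * 3 ^ k * Q).+1.
set i := (_ * Q).+1; have : 0 < Q ^ i by rewrite expn_gt0 Q0.
rewrite /i; nia.
Qed.

(** * Packing by double counting *)

(** After exchanging the sums, the index [i] counts the points of [B'] in the translate of [B] by
    [g i], which lies in [B'] and has [size B] elements. *)
Lemma sum_count_translates (G : groupType) (B B' : seq G) n (g : 'I_n -> G) :
  uniq B -> {in B, forall t i, (t * g i)%g \in B'} ->
  n * size B <= \sum_(x <- B') \sum_(i < n) ((x * (g i)^-1)%g \in B).
Proof.
move=> uB BB'; rewrite exchange_big /= -[n in n * _]card_ord -sum_nat_const.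
apply: leq_sum => i _.
have -> : \sum_(x <- B') ((x * (g i)^-1)%g \in B) = count (fun x => (x * (g i)^-1)%g \in B) B'.
  by rewrite -sum1_count [RHS]big_mkcond; apply: eq_bigr => x _; case: (_ \in _).
rewrite -(size_map (fun t => t * g i)%g) -size_filter.
apply: uniq_leq_size => [|_ /mapP[t tB ->]]; first by rewrite map_inj_uniq //; apply: mulIg.
by rewrite mem_filter mulgK tB BB'.
Qed.

Lemma LSP_admissible_growth (G : groupType) (k d : nat) :
  finitely_generated G -> growth_degree G k -> LSP_admissible G d (3 ^ k * (d + 1)).
Proof.
move=> Gfg Gk L /finite_seqP[l ->]; pose S := symmetrize l.
have S1 : 1%g \in S by rewrite inE eqxx.
have SV : {in S, forall y, (y^-1)%g \in S} by apply: symmetrizeV.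
have lS x : x \in l -> x \in S by move=> xl; rewrite inE mem_cat xl orbT.
have [K HK] := ball_growth S Gfg Gk.
have ball0 r : 0 < size (ball S r).
  by have := mem_ball_one r S1; case: (ball S r).
(* Taking [m = d + 1] makes the right-hand factor [3 ^ k * (d + 1) + 1], which is the least [n] to
   be treated. *)
have [|r r0 Hr] := @polynomial_growth_ratio (fun r => size (ball S r)) k K (d + 1) ball0 HK.
  by rewrite addn1.
exists [set` ball S (r + r)]; split.
- exact: finite_seq.
- exact: mem_ball_one.
- apply/seteqP; split=> [_ [x xB <-]|x xB]; first exact: ballV.
  by exists x^-1%g; [apply: ballV|rewrite invgK].
move=> n g ltn gP; set B := ball S r; set B' := ball S (3 * r + 1).
have gB t i : t \in B -> (t * g i)%g \in B'.
  move=> tB; have [a aB [b bl <-]] := gP i.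
  have -> : B' = ball S (r + ((r + r) + 1)) by congr ball; lia.
  by apply: ballM => //; apply: ballM => //; apply: mem_ball1; apply: lS.
pose F x : {set 'I_n} := [set i | (x * (g i)^-1)%g \in B]%SET.
(* If every point lay in at most [d + 1] translates, then [n * size B <= (d + 1) * size B'], against
   [Hr]. *)
have [x Fx] : exists x, d + 1 < #|F x|.
  apply: contrapT => H.
  have {}H x : #|F x| <= d + 1 by rewrite leqNgt; apply/negP => lt; apply: H; exists x.
  have upper : \sum_(x <- B') #|F x| <= (d + 1) * size B'.
    by rewrite mulnC -sum1_size big_distrl /=; apply: leq_sum => x _; rewrite mul1n.
  have lower : n * size B <= \sum_(x <- B') #|F x|.
    apply: leq_trans (@sum_count_translates _ B B' n g (ball_uniq _ _) _) _.
      by move=> t tB i; apply: gB.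
    apply: leq_sum => x _; rewrite -sum1dep_card [X in _ <= X]big_mkcond /=.
    by apply: leq_sum => i _; case: (_ \in _).
  move: (leq_trans lower upper) Hr; rewrite -/B -/B' => H1 H2.
  have : (3 ^ k * (d + 1) + 1) * size B <= n * size B by rewrite leq_mul2r addn1 ltn orbT.
  lia.
exists (F x); split=> // i j; rewrite !inE => iF jF.
have -> : (g i * (g j)^-1 = (x * (g i)^-1)^-1 * (x * (g j)^-1))%g.
  by rewrite invgM invgK mulgA mulgVK.
by apply: ballM => //; apply: ballV.
Qed.

Theorem theorem7p5 (R : realType) (G : groupType)
  (Gfg : finitely_generated G) (Gvn : is_virtually_nilpotent G)
  (k : nat) (kE : growth_degree G k) (d : nat) :
  (LSP R d G <= ((3 ^ k * (d + 1))%N%:R)%:E)%E.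
Proof.
apply: ereal_inf_lbound; exists (3 ^ k * (d + 1))%N => //.
exact: LSP_admissible_growth.
Qed.
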